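(* Let the speed be $v=1$. The intensity of the max interference point process $\mathcal V_I$ is $\lambda_I=\frac{\sqrt\lambda}{2}$.
   Context: Model. Let $\lambda>0$. $\Phi=\sum_i\delta_{X_i}$ is a homogeneous Poisson point process of intensity $\lambda$ on $\mathbb R^2$ and $(\Theta_i)$ are i.i.d. uniform angles on $[-\pi,\pi)$, independent of $\Phi$. Base station (BS) $i$ is at $X_i^t=X_i+vt(\cos\Theta_i,\sin\Theta_i)$ at time $t\in\mathbb R$, with $v$ the common speed; $d_i(t)=\|X_i^t\|$ is its distance to the user at the origin. $T_i$ is the time at which $d_i$ is minimal and $H_i=d_i(T_i)$. The max interference point process $\mathcal V_I$ is the point process on the time axis $\mathbb R$ consisting of the times $T_i$ such that BS $i$ is the second nearest BS at time $T_i$, i.e. exactly one BS $j$ satisfies $d_j(T_i)<H_i$. It is stationary; its intensity is the mean number of its points in $[0,1]$. *)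

(* Defs.v *)
From HB Require Import structures.
From mathcomp Require Import all_boot all_order all_algebra finmap.
From mathcomp Require Import all_classical all_reals all_analysis.
From mathcomp Require Import measurable_realfun.

Set Implicit Arguments.
Unset Strict Implicit.
Unset Printing Implicit Defensive.

Import Order.TTheory GRing.Theory Num.Theory.
Import numFieldNormedType.Exports.

Local Open Scope classical_set_scope.
Local Open Scope ring_scope.

Section probability.
Context d {Omega : measurableType d} {R : realType} (P : probability Omega R).

Definition mutually_independent (I : choiceType) (F : I -> set (set Omega)) :=
  forall (J : {fset I}) (E : I -> set Omega),
    (forall i, i \in J -> F i (E i)) ->
    P (\bigcap_(i in [set` J]) E i) = (\prod_(i <- J) P (E i))%E.

Definition generated_by d' {T : measurableType d'} (Y : Omega -> T) :
    set (set Omega) :=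
  preimage_set_system setT Y measurable.

Definition generated_by_seq d' {T : measurableType d'} (Y : nat -> Omega -> T) :
    set (set Omega) :=
  <<s \bigcup_i generated_by (Y i) >>.

Definition independent_rvs (I : choiceType) d' {T : measurableType d'}
    (Y : I -> Omega -> T) :=
  mutually_independent (fun i => generated_by (Y i)).

Definition independent_seqs d1 d2 {T1 : measurableType d1}
    {T2 : measurableType d2} (Y : nat -> Omega -> T1) (Z : nat -> Omega -> T2) :=
  forall A B, generated_by_seq Y A -> generated_by_seq Z B ->
    P (A `&` B) = (P A * P B)%E.

End probability.

Notation plane R := (measurableTypeR R * measurableTypeR R)%type.

Section plane.
Context {R : realType}.

Definition area : set (plane R) -> \bar R :=
  (@lebesgue_measure R \x @lebesgue_measure R)%E.

(* The canonical norm on a product type is the sup norm, hence this one. *)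
Definition euclidean_norm (x : plane R) : R :=
  Num.sqrt ((x.1 : R) ^+ 2 + (x.2 : R) ^+ 2).

Lemma ltNpipi : - pi < pi :> R.
Proof. by rewrite gtrN ?pi_gt0. Qed.

(* The library puts the uniform law on the closed interval, which is the same
   measure as the uniform law on [-pi, pi). *)
Definition uniform_angle : set R -> \bar R := uniform_prob ltNpipi.

End plane.

Section poisson_process.
Context d {Omega : measurableType d} {R : realType} (P : probability Omega R).

(* Phi B, for Phi = \sum_i delta_(X i). *)
Definition point_count (X : nat -> Omega -> plane R) (B : set (plane R))
    (w : Omega) : \bar R :=
  counting [set i | B (X i w)].

(* The second argument of poisson_prob is not used by its definition.
   poisson_prob handles the rate 0 (unit mass at 0), poisson_pmf does not. *)
Definition homogeneous_poisson (lambda : R) (X : nat -> Omega -> plane R) :=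
  (forall (B : set (plane R)) (n : nat),
     measurable B -> (area B < +oo)%E ->
     P [set w | point_count X B w = n%:R%:E] =
     poisson_prob (lambda * fine (area B)) 0 [set n]) /\
  (forall (k : nat) (B : 'I_k -> set (plane R)),
     (forall i, measurable (B i)) -> trivIset setT B ->
     independent_rvs P (fun i => point_count X (B i))).

Definition iid_uniform_angles (Theta : nat -> Omega -> R) :=
  (forall (i : nat) (A : set R), measurable A ->
     P (Theta i @^-1` A) = uniform_angle A) /\
  independent_rvs P Theta.

End poisson_process.

Section network.
Context {Omega : Type} {R : realType} (v : R).
Variables (X : nat -> Omega -> plane R) (Theta : nat -> Omega -> R).
Implicit Types (i j : nat) (t : R) (w : Omega).

Definition position i t w : plane R :=
  (((X i w).1 : R) + v * t * cos (Theta i w),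
   ((X i w).2 : R) + v * t * sin (Theta i w)).

Definition user_dist i t w : R := euclidean_norm (position i t w).

(* The minimiser exists and is unique as soon as v != 0. *)
Definition closest_time i w : R :=
  xget 0 [set t | forall s, user_dist i t w <= user_dist i s w].

Definition closest_dist i w : R := user_dist i (closest_time i w) w.

Definition second_nearest_at_closest i w : Prop :=
  exists! j, user_dist j (closest_time i w) w < closest_dist i w.

(* The random counting measure \sum_i delta_(T_i), over the i such that BS i is
   the second nearest one at time T_i. *)
Definition max_interference_process (A : set R) (w : Omega) : \bar R :=
  counting [set i | A (closest_time i w) /\ second_nearest_at_closest i w].

End network.

Definition intensity d {Omega : measurableType d} {R : realType}
    (P : probability Omega R) (N : set R -> Omega -> \bar R) : \bar R :=
  (\int[P]_w N `[0%R, 1%R]%classic w)%E.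

(* Main.v *)
From HB Require Import structures.
Require Import Defs.
From mathcomp Require Import all_boot all_order all_algebra finmap.
From mathcomp Require Import all_classical all_reals all_analysis.
From mathcomp Require Import measurable_realfun ring lra.

Set Implicit Arguments.
Unset Strict Implicit.
Unset Printing Implicit Defensive.

Import Order.TTheory GRing.Theory Num.Theory.
Import numFieldNormedType.Exports.
Import HBNNSimple.

Local Open Scope classical_set_scope.
Local Open Scope ring_scope.

(** Write Z_i for the position of station i at time 0 together with its
    direction, T z for the time at which z is closest to the user and q z for
    its signed distance at that time. Station j is closer than i at the passage
    of i exactly when (Z_i, Z_j) lies in a fixed set U of pairs of stations. Let
    N_i be the number of such j. The intensity is the coefficient of r in

      G r = E sum_i [0 <= T Z_i <= 1] r ^ N_i,

    because a station is counted when N_i = 1.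

    The points Z_i form a Poisson process with intensity mu = (lambda times the
    area) x (uniform law of the angle), so the Mecke formula gives

      G r = \int_(0 <= T z <= 1) exp (- (1 - r) mu (U z)) dmu z.

    In the coordinates (T z, q z), which for each direction are the image of the
    position by a rotation and a reflection, mu has density lambda. The stations
    that are closer at the passage of z fill, for each of their directions, a
    disc of radius |q z|, hence mu (U z) = lambda pi (q z)^2. The integral is a
    Gaussian one and G r = sqrt lambda / sqrt (1 - r) (mean_sum_passage). The
    coefficient of r in this function is sqrt lambda / 2 (expected_singletons).

    The Mecke formula is derived from the counts of the stations. Independence of
    the counts in disjoint sets gives the generating functional
    E prod_j (1 - f (X_j)) = exp (- \int f) for simple f, hence for all f by a
    monotone limit (generating_functional_poisson). Integrating out the angles,
    which are independent of the positions, transfers it to the Z_j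
    (expectation_marks, marked_generating_functional). Differentiating it gives
    E sum_i [Z_i in A] r ^ #{j | Z_j in D} = mu A exp (- (1 - r) mu D) for
    disjoint A and D (expected_sum_pow_card). Since U is a countable union of
    rectangles A_k x B_k, and A_k does not meet B_k because no station is closer
    than itself, this formula can be summed over pieces of the window on which
    finitely many rectangles show a constant set D (mecke_rectangles); letting
    the number of rectangles grow yields mecke_pow_card. *)

(** * Weighted images of measures *)

Section weighted_images.
Local Open Scope ereal_scope.
Context dS (S : measurableType dS) (R : realType).
Implicit Types (d : measure_display).

(** The integral of g for the image by phi of the measure with density W with
    respect to mu. *)
Definition weighted_integral d (T : measurableType d)
    (mu : {measure set T -> \bar R}) (phi : T -> S) (W : T -> R)
    (g : S -> \bar R) : \bar R :=
  \int[mu]_t (g (phi t) * (W t)%:E).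

Section one_weight.
Context d (T : measurableType d) (mu : {measure set T -> \bar R}).
Variables (phi : T -> S) (W : T -> R).
Hypotheses (mphi : measurable_fun setT phi) (mW : measurable_fun setT W).
Hypothesis W0 : forall t, (0 <= W t)%R.

Local Notation L := (weighted_integral mu phi W).

Lemma weighted_integral_bigcup (F : (set S)^nat) :
  (forall n, measurable (F n)) -> trivIset setT F ->
  L (fun s => (\1_(\bigcup_n F n) s)%:E) =
  \sum_(n <oo) L (fun s => (\1_(F n) s)%:E).
Proof.
move=> mF tF; rewrite /weighted_integral -integral_nneseries//; last 2 first.
  - move=> n; apply: emeasurable_funM; apply/measurable_EFinP => //.
    by apply: measurableT_comp => //; exact: measurable_indic.
  - by move=> n t _; rewrite mule_ge0// lee_fin.
apply: eq_integral => t _.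
transitivity (\d_(phi t) (\bigcup_n F n) * (W t)%:E) => //.
rewrite measure_bigcup//.
rewrite [LHS]muleC -nneseriesZl//.
rewrite (eq_eseriesl (Q := xpredT))/=; last by move=> n; rewrite in_setT.
by apply: eq_eseriesr => n _; rewrite muleC.
Qed.

Lemma weighted_integralC (A : set S) : measurable A -> \int[mu]_t (W t)%:E < +oo ->
  L (fun s => (\1_(~` A) s)%:E) = \int[mu]_t (W t)%:E - L (fun s => (\1_A s)%:E).
Proof.
move=> mA Woo.
have m1 B : measurable B -> measurable_fun setT (fun t => (\1_B (phi t))%:E * (W t)%:E).
  move=> mB; apply: emeasurable_funM; apply/measurable_EFinP => //.
  by apply: measurableT_comp => //; exact: measurable_indic.
have h : \int[mu]_t (W t)%:E = L (fun s => (\1_(~` A) s)%:E) + L (fun s => (\1_A s)%:E).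
  rewrite /weighted_integral -ge0_integralD//.
  - apply: eq_integral => t _; rewrite -ge0_muleDl ?lee_fin// -EFinD.
    by rewrite indicC/= indicE; case: (_ \in A); rewrite /= ?subrr ?subr0 ?addr0 ?add0r mul1e.
  - by move=> t _; rewrite mule_ge0// lee_fin.
  - exact/m1/measurableC.
  - by move=> t _; rewrite mule_ge0// lee_fin.
  - exact: m1.
have L0 B : 0 <= L (fun s => (\1_B s)%:E).
  by apply: integral_ge0 => t _; rewrite mule_ge0// lee_fin.
rewrite h addeK// ge0_fin_numE//.
by apply: le_lt_trans Woo; rewrite h leeDr.
Qed.

Lemma weighted_integral_nnsfun (h : {nnsfun S >-> R}) :
  L (EFin \o h) =
  \sum_(x \in range h) (x%:E * L (fun s => (\1_(h @^-1` [set x]) s)%:E)).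
Proof.
have mI x : measurable_fun setT (fun t => (\1_(h @^-1` [set x]) (phi t))%:E * (W t)%:E).
  apply: emeasurable_funM; apply/measurable_EFinP => //.
  by apply: measurableT_comp => //; exact: measurable_indic.
transitivity (\int[mu]_t (\sum_(x \in range h)
    (x%:E * ((\1_(h @^-1` [set x]) (phi t))%:E * (W t)%:E)))).
  apply: eq_integral => t _ /=; rewrite fimfunE -fsumEFin//.
  rewrite ge0_mule_fsuml//; last by move=> x; rewrite nnfun_muleindic_ge0.
  by apply: eq_fsbigr => x _; rewrite EFinM muleA.
rewrite ge0_integral_fsum//; last 2 first.
  - by move=> x; exact: measurable_funeM.
  - move=> x t _; rewrite muleA mule_ge0//.
      by rewrite -EFinM nnfun_muleindic_ge0.
    by rewrite lee_fin.
apply: eq_fsbigr => x; rewrite inE => -[s _ <-].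
by rewrite ge0_integralZl ?lee_fin// => t _; rewrite mule_ge0// lee_fin.
Qed.

Lemma weighted_integral_approx (g : S -> \bar R) (mg : measurable_fun setT g) :
  (forall s, 0 <= g s) ->
  L g = limn (fun n => L (EFin \o nnsfun_approx measurableT mg n)).
Proof.
move=> g0; set a := nnsfun_approx measurableT mg.
rewrite /weighted_integral -monotone_convergence//=.
- apply: eq_integral => t _; apply/esym/cvg_lim => //.
  by apply: cvgeZr => //; exact: cvg_nnsfun_approx.
- move=> n; apply: emeasurable_funM; apply/measurable_EFinP => //.
  exact: measurableT_comp.
- by move=> n t _; rewrite mule_ge0// lee_fin.
- move=> t _ m n mn; apply: lee_wpmul2r; rewrite lee_fin//.
  exact/lefP/nd_nnsfun_approx.
Qed.

End one_weight.

(** By the pi-lambda theorem a finite weighted image of a measure is determined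
    by its values on a generating pi-system, and hence so are the integrals of
    all nonnegative functions. *)
Lemma eq_weighted_integral (G : set (set S)) d1 (T1 : measurableType d1)
    (mu1 : {measure set T1 -> \bar R}) (phi1 : T1 -> S) (W1 : T1 -> R)
    d2 (T2 : measurableType d2) (mu2 : {measure set T2 -> \bar R})
    (phi2 : T2 -> S) (W2 : T2 -> R) (g : S -> \bar R) :
  measurable = <<s G >> -> setI_closed G -> G setT ->
  measurable_fun setT phi1 -> measurable_fun setT W1 -> (forall t, (0 <= W1 t)%R) ->
  \int[mu1]_t (W1 t)%:E < +oo ->
  measurable_fun setT phi2 -> measurable_fun setT W2 -> (forall t, (0 <= W2 t)%R) ->
  (forall A, G A -> weighted_integral mu1 phi1 W1 (fun s => (\1_A s)%:E) =
                    weighted_integral mu2 phi2 W2 (fun s => (\1_A s)%:E)) ->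
  measurable_fun setT g -> (forall s, 0 <= g s) ->
  weighted_integral mu1 phi1 W1 g = weighted_integral mu2 phi2 W2 g.
Proof.
move=> mG GI GT mphi1 mW1 W10 W1oo mphi2 mW2 W20 GE mg g0.
have W12 : \int[mu1]_t (W1 t)%:E = \int[mu2]_t (W2 t)%:E.
  have := GE _ GT; rewrite /weighted_integral.
  under eq_integral do rewrite indicT mul1e.
  by under [X in _ = X]eq_integral do rewrite indicT mul1e.
have E A : measurable A -> weighted_integral mu1 phi1 W1 (fun s => (\1_A s)%:E) =
                    weighted_integral mu2 phi2 W2 (fun s => (\1_A s)%:E).
  move=> mA; have sA : <<s G >> A by rewrite -mG.
  apply: (dynkin_induction (P := fun A =>
    weighted_integral mu1 phi1 W1 (fun s => (\1_A s)%:E) =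
    weighted_integral mu2 phi2 W2 (fun s => (\1_A s)%:E)) mG GI _ _ _ _ sA).
  - exact: GE.
  - exact: GE.
  - by move=> B mB EB; rewrite !weighted_integralC// -?W12// EB.
  - move=> F mF tF EF; rewrite !weighted_integral_bigcup//.
    by apply: eq_eseriesr => n _.
rewrite (weighted_integral_approx _ _ _ _ mg)// (weighted_integral_approx _ _ _ _ mg)//.
apply: congr_lim; apply/funext => n.
rewrite !weighted_integral_nnsfun//.
by apply: eq_fsbigr => x _; rewrite E//; exact: measurable_sfunP.
Qed.

End weighted_images.

(** * Products of independent variables *)

Section slotwise.
Context (S : Type) (R : realType) (n : nat).
Implicit Types (f : 'I_n -> S -> R) (g : S -> R).

Definition with_slot f (m : 'I_n) g : 'I_n -> S -> R :=
  fun i => if i == m then g else f i.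

Lemma with_slotK f m : with_slot f m (f m) = f.
Proof. by apply/funext => i; rewrite /with_slot; case: eqP => // ->. Qed.

Lemma prod_with_slot f m g (a : 'I_n -> S) :
  \prod_i with_slot f m g i (a i) = g (a m) * \prod_(i | i != m) f i (a i).
Proof.
rewrite (bigD1 m)//= /with_slot eqxx; congr (_ * _).
by apply: eq_bigr => i /negbTE ->.
Qed.

(** The slots are released from C0 to C one at a time. The slot hypothesis is
    the place to apply a uniqueness theorem for measures, with the test functions
    of the other slots held fixed. *)
Lemma eq_slotwise (V : Type) (C0 C : set (S -> R))
    (L1 L2 : ('I_n -> S -> R) -> V) :
  C0 `<=` C ->
  (forall f m, (forall i, C (f i)) ->
    (forall g, C0 g -> L1 (with_slot f m g) = L2 (with_slot f m g)) ->
    L1 f = L2 f) ->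
  (forall f, (forall i, C0 (f i)) -> L1 f = L2 f) ->
  forall f, (forall i, C (f i)) -> L1 f = L2 f.
Proof.
move=> C0C slot base.
suff H k f : (forall i, C (f i)) ->
    (forall i : 'I_n, (k <= i)%N -> C0 (f i)) -> L1 f = L2 f.
  by move=> f Cf; apply: (H n) => // i; rewrite leqNgt ltn_ord.
elim: k f => [|k IH] f Cf C0f; first by apply: base => i; exact: C0f.
have [kn|nk] := ltnP k n; last first.
  by apply: IH => // i ki; have := leq_trans nk ki; rewrite leqNgt ltn_ord.
apply: (slot _ (Ordinal kn)) => // g C0g; apply: IH => [i|i ki].
  by rewrite /with_slot; case: ifP => // _; exact: C0C.
rewrite /with_slot; case: eqP => // /eqP ik; apply: C0f.
by rewrite ltn_neqAle ki andbT; apply: contra ik => /eqP ik; exact/eqP/val_inj.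
Qed.

End slotwise.

Section products.
Context d (Omega : measurableType d) (R : realType) (P : probability Omega R).

Definition unit_interval_valued dT (T : measurableType dT) (f : T -> R) :=
  measurable_fun setT f /\ forall x, 0 <= f x <= 1.

Lemma unit_interval_valued_indic dT (T : measurableType dT) (A : set T) :
  measurable A -> unit_interval_valued (\1_A : T -> R).
Proof.
move=> mA; split; first exact: measurable_indic.
by move=> x; rewrite indicE ler0n lern1 leq_b1.
Qed.

Lemma unit_interval_valued_prod dT (T : measurableType dT) (I : eqType)
    (s : seq I) (p : pred I) (f : I -> T -> R) :
  (forall i, unit_interval_valued (f i)) ->
  unit_interval_valued (fun x => \prod_(i <- s | p i) f i x).
Proof.
move=> f01; split.
  under eq_fun do rewrite big_mkcond.
  apply: measurable_prod => i _; case: (p i) => //.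
  by case: (f01 i).
move=> x; rewrite prodr_ge0/=; last by move=> i _; case: (f01 i) => _ /(_ x)/andP[].
by apply: prodr_ile1 => i _; case: (f01 i).
Qed.

Lemma unit_interval_valued_comp d1 (T1 : measurableType d1)
    d2 (T2 : measurableType d2) (f : T2 -> R) (Y : T1 -> T2) :
  measurable_fun setT Y -> unit_interval_valued f ->
  unit_interval_valued (f \o Y).
Proof. by move=> mY [mf f01]; split => //=; exact: measurableT_comp. Qed.

Lemma integral_unit_interval_valued dT (T : measurableType dT)
    (Q : probability T R) (f : T -> R) : unit_interval_valued f ->
  (0 <= \int[Q]_x (f x)%:E <= 1)%E.
Proof.
move=> [mf f01]; apply/andP; split.
  by apply: integral_ge0 => x _; rewrite lee_fin; case/andP: (f01 x).
rewrite -[leRHS](probability_setT Q) -[leRHS]mul1e -integral_cst//.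
apply: ge0_le_integral => //.
- by move=> x _; rewrite lee_fin; case/andP: (f01 x).
- exact/measurable_EFinP.
- by move=> x _; rewrite lee_fin; case/andP: (f01 x).
Qed.

Lemma integral_unit_fin_num dT (T : measurableType dT)
    (Q : probability T R) (f : T -> R) : unit_interval_valued f ->
  (\int[Q]_x (f x)%:E)%E \is a fin_num.
Proof.
move=> /(integral_unit_interval_valued Q)/andP[f0 f1].
by rewrite ge0_fin_numE// (le_lt_trans f1)// ltry.
Qed.

Lemma prode_fine (I : eqType) (s : seq I) (p : pred I) (x : I -> \bar R) :
  (forall i, x i \is a fin_num) ->
  (\prod_(i <- s | p i) x i)%E = (\prod_(i <- s | p i) fine (x i))%:E.
Proof.
move=> xfin; rewrite -prodEFin; apply: eq_bigr => i _.
by rewrite fineK.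
Qed.

(** With the other factors held fixed, each side is the integral of one test
    function for a finite weighted image of P, and the definition of independence
    is the case of indicators. *)
Lemma expectation_prod_independent k dT (T : measurableType dT)
    (Y : 'I_k -> Omega -> T) (f : 'I_k -> T -> R) :
  (forall i, measurable_fun setT (Y i)) -> independent_rvs P Y ->
  (forall i, unit_interval_valued (f i)) ->
  (\int[P]_w (\prod_i f i (Y i w))%:E = \prod_i \int[P]_w (f i (Y i w))%:E)%E.
Proof.
move=> mY indep; move: f.
apply: (@eq_slotwise T R k _ [set g | exists2 A, measurable A & g = \1_A]
  (@unit_interval_valued _ T)
  (fun f => \int[P]_w (\prod_i f i (Y i w))%:E)%E
  (fun f => \prod_i \int[P]_w (f i (Y i w))%:E)%E).
- by move=> _ [A mA ->]; exact: unit_interval_valued_indic.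
- move=> f m f01 fm.
  have fY01 i : unit_interval_valued (f i \o Y i).
    exact: unit_interval_valued_comp.
  have mf i : measurable_fun setT (f i) by case: (f01 i).
  pose W1 w := \prod_(i | i != m) f i (Y i w).
  pose c := \prod_(i | i != m) fine (\int[P]_w (f i (Y i w))%:E)%E.
  have W101 : unit_interval_valued W1 by exact: unit_interval_valued_prod.
  have c0 : 0 <= c.
    apply: prodr_ge0 => i _; rewrite fine_ge0//.
    by have /andP[] := integral_unit_interval_valued P (fY01 i).
  have E1 g : (\int[P]_w (\prod_i with_slot f m g i (Y i w))%:E =
      weighted_integral P (Y m) W1 (EFin \o g))%E.
    by apply: eq_integral => w _; rewrite prod_with_slot EFinM.
  have E2 g : unit_interval_valued g ->
     (\prod_i \int[P]_w (with_slot f m g i (Y i w))%:E =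
      weighted_integral P (Y m) (cst c) (EFin \o g))%E.
    move=> [mg g01]; rewrite (bigD1 m)//=.
    rewrite [X in (_ * X)%E](_ : _ = c%:E); last first.
      rewrite (eq_bigr (fun i => \int[P]_w (f i (Y i w))%:E)%E); last first.
        by move=> i im; rewrite /with_slot (negbTE im).
      by rewrite prode_fine// => i; exact: (integral_unit_fin_num P (fY01 i)).
    rewrite /weighted_integral/= ge0_integralZr ?lee_fin//.
    - by rewrite /with_slot eqxx.
    - by apply/measurable_EFinP; exact: measurableT_comp.
    - by move=> w _; rewrite lee_fin; case/andP: (g01 (Y m w)).
  rewrite -{1 2}(with_slotK f m) E1 E2//.
  apply: (eq_weighted_integral (G := measurable)) => //.
  + by rewrite sigma_algebra_id//; exact: sigma_algebra_measurable.
  + exact: measurableI.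
  + by case: W101.
  + by move=> w; case: W101 => _ /(_ w)/andP[].
  + have /andP[_ h] := integral_unit_interval_valued P W101.
    by rewrite (le_lt_trans h)// ltry.
  + move=> A mA; rewrite -(E1 \1_A) -(E2 \1_A); last exact: unit_interval_valued_indic.
    by apply: fm; exists A.
  + by apply/measurable_EFinP.
  + by move=> x; rewrite lee_fin; case: (f01 m) => _ /(_ x)/andP[].
- move=> f f1.
  have /choice[A /all_and2[mA fA]] i : exists A, measurable A /\ f i = \1_A.
    by have /= [A mA fA] := f1 i; exists A.
  have {fA}-> : f = fun i => \1_(A i) by apply/funext.
  pose J := [fset i | i in 'I_k]%fset.
  have J_perm : perm_eq J (index_enum 'I_k).
    apply: uniq_perm; rewrite ?fset_uniq ?index_enum_uniq// => i.
    by rewrite mem_index_enum; apply/imfsetP; exists i.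
  have := indep J (fun i => Y i @^-1` A i).
  rewrite (perm_big _ J_perm)/= => H.
  transitivity (P (\bigcap_(i in [set` J]) (Y i @^-1` A i))).
    rewrite -[X in P X]setIT -integral_indic//; last first.
      apply: fin_bigcap_measurable => // i _; rewrite -[X in measurable X]setTI.
      exact: mY.
    apply: eq_integral => w _; congr EFin; rewrite indicE.
    case: (pselect (forall i, A i (Y i w))) => h.
      rewrite big1 => [|i _]; last by rewrite indicE mem_set.
      by rewrite mem_set// => i _; exact: h.
    have /existsNP[i Ai] := h.
    rewrite (bigD1 i)//= indicE (memNset Ai) mul0r memNset//.
    by move=> /(_ i); apply: contra_not Ai; apply; apply/imfsetP; exists i.
  rewrite H; last first.
    by move=> i _; exists (A i) => //; rewrite setTI.
  apply: eq_bigr => i _; rewrite -[X in P X]setIT -integral_indic//.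
  by rewrite -[X in measurable X]setTI; exact: mY.
Qed.

End products.

(** * Integrating out independent marks *)

Section marks.
Context d (Omega : measurableType d) (R : realType) (P : probability Omega R).
Context d1 (T1 : measurableType d1) d2 (T2 : measurableType d2).
Variable U : probability T2 R.

Definition mark_mean (g : T1 * T2 -> R) (x : T1) : R :=
  fine (\int[U]_y (g (x, y))%:E)%E.

Lemma unit_interval_valued_section (g : T1 * T2 -> R) x :
  unit_interval_valued g -> unit_interval_valued (fun y => g (x, y)).
Proof.
move=> [mg g01]; split => //.
exact: measurableT_comp.
Qed.

Lemma mark_meanE (g : T1 * T2 -> R) x : unit_interval_valued g ->
  (mark_mean g x)%:E = (\int[U]_y (g (x, y))%:E)%E.
Proof.
move=> g01; rewrite fineK//; apply: integral_unit_fin_num.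
exact: unit_interval_valued_section.
Qed.

Lemma unit_interval_valued_mark_mean (g : T1 * T2 -> R) :
  unit_interval_valued g -> unit_interval_valued (mark_mean g).
Proof.
move=> g01; split.
  apply/measurable_EFinP; rewrite (_ : _ \o _ = fubini_F U (EFin \o g)).
    apply: measurable_fun_fubini_tonelli_F => //.
      by apply/measurable_EFinP; case: g01.
    by move=> z; rewrite lee_fin; case: g01 => _ /(_ z)/andP[].
  by apply/funext => x /=; rewrite mark_meanE.
move=> x; rewrite -!lee_fin mark_meanE//; apply: integral_unit_interval_valued.
exact: unit_interval_valued_section.
Qed.

Lemma mark_mean_rectangle (A : set T1) (B : set T2) x : measurable B ->
  mark_mean \1_(A `*` B) x = \1_A x * fine (U B).
Proof.
move=> mB; rewrite /mark_mean.
rewrite (eq_integral (fun y => (\1_A x)%:E * (\1_B y)%:E)%E); last first.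
  move=> y _; rewrite -EFinM !indicE in_setX/=.
  by case: (x \in A); case: (y \in B); rewrite ?mulr1 ?mulr0 ?mul0r.
rewrite ge0_integralZl ?lee_fin//; last by apply/measurable_EFinP; exact: measurable_indic.
rewrite integral_indic// setIT fineM// fin_num_measure//.
Qed.

Variables (X : nat -> Omega -> T1) (Th : nat -> Omega -> T2).
Hypotheses (mX : forall i, measurable_fun setT (X i))
  (mTh : forall i, measurable_fun setT (Th i)).
Hypothesis Th_law : forall i A, measurable A -> P (Th i @^-1` A) = U A.
Hypothesis Th_indep : independent_rvs P Th.
Hypothesis XTh : independent_seqs P X Th.

Let rectangles : set (set (T1 * T2)) :=
  [set C | exists2 A, measurable A & exists2 B, measurable B & C = A `*` B].

Lemma generated_by_seq_bigcap dT (T : measurableType dT) (Y : nat -> Omega -> T)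
    n (A : 'I_n -> set T) : (forall i, measurable (A i)) ->
  generated_by_seq Y (\bigcap_(i : 'I_n) Y i @^-1` A i).
Proof.
move=> mA; apply: (@fin_bigcap_measurable _
  (g_sigma_algebraType (\bigcup_i generated_by (Y i)))) => // i _.
apply: sub_sigma_algebra; exists (val i) => //.
by exists (A i) => //; rewrite setTI.
Qed.

Let probability_marks n (B : 'I_n -> set T2) : (forall i, measurable (B i)) ->
  P (\bigcap_(i : 'I_n) Th i @^-1` B i) = (\prod_(i < n) U (B i))%E.
Proof.
move=> mB; pose J := [fset (val i) | i in 'I_n]%fset.
pose B' i := if insub i is Some j then B j else setT.
have B'E (j : 'I_n) : B' j = B j by rewrite /B' insubT//= => h; congr B; exact/val_inj.
have mB' i : measurable (B' i) by rewrite /B'; case: insubP.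
rewrite (_ : \bigcap_i _ = \bigcap_(i in [set` J]) (Th i @^-1` B' i)); last first.
  apply/seteqP; split => w h.
    by move=> _ /imfsetP[j _ ->] /=; rewrite B'E; exact: h.
  move=> j _ /=; rewrite -B'E; apply: (h (val j)) => /=.
  by apply/imfsetP; exists j.
rewrite Th_indep; last first.
  by move=> i _; exists (B' i) => //; rewrite setTI.
have J_perm : perm_eq J (index_iota 0 n).
  apply: uniq_perm; rewrite ?fset_uniq ?iota_uniq// => i.
  rewrite mem_index_iota/=; apply/imfsetP/idP => /= [[j _ ->]|ni]; first by case: j.
  by exists (Ordinal ni).
rewrite (perm_big _ J_perm)/= big_mkord; apply: eq_bigr => i _.
by rewrite Th_law// B'E.
Qed.

(** In each slot both sides are integrals of the test function for a finite
    measure on T1 * T2, which on the right is by Tonelli a weighted image of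
    P \x U. It is therefore enough to treat rectangles, where the identity
    combines the two independence hypotheses. *)
Lemma expectation_marks n (f : 'I_n -> T1 * T2 -> R) :
  (forall i, unit_interval_valued (f i)) ->
  (\int[P]_w (\prod_i f i (X i w, Th i w))%:E =
   \int[P]_w (\prod_i mark_mean (f i) (X i w))%:E)%E.
Proof.
have mXT i : measurable_fun setT (fun w => (X i w, Th i w)).
  exact: measurable_fun_pair.
have mR C : rectangles C -> measurable C.
  by move=> [A mA [B mB ->]]; exact: measurableX.
move: f.
apply: (@eq_slotwise (T1 * T2) R n _ [set g | exists2 C, rectangles C & g = \1_C]
  (@unit_interval_valued _ _ _)
  (fun f => \int[P]_w (\prod_i f i (X i w, Th i w))%:E)%E
  (fun f => \int[P]_w (\prod_i mark_mean (f i) (X i w))%:E)%E).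
- by move=> _ [C rC ->]; apply: unit_interval_valued_indic; exact: mR.
- move=> f m f01 fm.
  pose W1 w := \prod_(i | i != m) f i (X i w, Th i w).
  pose W2 w := \prod_(i | i != m) mark_mean (f i) (X i w).
  have W101 : unit_interval_valued W1.
    by apply: unit_interval_valued_prod => i; exact: (unit_interval_valued_comp (mXT i)).
  have W201 : unit_interval_valued W2.
    apply: unit_interval_valued_prod => i.
    apply: (unit_interval_valued_comp (mX i)).
    exact: unit_interval_valued_mark_mean.
  have E1 g : (\int[P]_w (\prod_i with_slot f m g i (X i w, Th i w))%:E =
      weighted_integral P (fun w => (X m w, Th m w)) W1 (EFin \o g))%E.
    apply: eq_integral => w _.
    by rewrite (prod_with_slot f m g (fun i => (X i w, Th i w))) EFinM.
  have E2 g : unit_interval_valued g ->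
     (\int[P]_w (\prod_i mark_mean (with_slot f m g i) (X i w))%:E =
      weighted_integral (P \x U) (fun z => (X m z.1, z.2)) (W2 \o fst) (EFin \o g))%E.
    move=> g01; rewrite /weighted_integral fubini_tonelli1//=; last 2 first.
    + apply: emeasurable_funM; apply/measurable_EFinP.
        case: g01 => mg _; apply: (measurableT_comp mg).
        by apply: measurable_fun_pair => //; exact: measurableT_comp.
      by case: W201 => mW2 _; exact: measurableT_comp.
    + by move=> z; rewrite -EFinM lee_fin mulr_ge0//;
        [case: g01 => _ /(_ (X m z.1, z.2))/andP[]|case: W201 => _ /(_ z.1)/andP[]].
    apply: eq_integral => w _; rewrite (bigD1 m)//= /fubini_F/=.
    rewrite ge0_integralZr ?lee_fin//; last 3 first.
    + by apply/measurable_EFinP; case: (unit_interval_valued_section (X m w) g01).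
    + by move=> y _; rewrite lee_fin; case: g01 => _ /(_ (X m w, y))/andP[].
    + by case: W201 => _ /(_ w)/andP[].
    rewrite -mark_meanE// -EFinM /with_slot eqxx; congr (_ * _)%:E.
    by apply: eq_bigr => i im; rewrite (negbTE im).
  rewrite -{1 2}(with_slotK f m) E1 E2//.
  apply: (eq_weighted_integral (G := rectangles)) => //.
  + rewrite measurable_prod_measurableType; congr (<<s _ >>).
    apply/seteqP; split => [_ [A mA [B mB <-]]|_ [A mA [B mB ->]]].
      by exists A => //; exists B.
    by exists A => //; exists B.
  + move=> _ _ [A mA [B mB ->]] [A' mA' [B' mB' ->]].
    exists (A `&` A'); first exact: measurableI.
    by exists (B `&` B'); [exact: measurableI|rewrite setXI].
  + by exists setT => //; exists setT => //; rewrite setXTT.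
  + by case: W101.
  + by move=> w; case: W101 => _ /(_ w)/andP[].
  + have /andP[_ h] := integral_unit_interval_valued P W101.
    by rewrite (le_lt_trans h)// ltry.
  + by apply: measurable_fun_pair => //; exact: measurableT_comp.
  + by case: W201 => mW2 _; exact: measurableT_comp.
  + by move=> z; case: W201 => _ /(_ z.1)/andP[].
  + move=> C rC; rewrite -(E1 \1_C) -(E2 \1_C); last by apply: unit_interval_valued_indic; exact: mR.
    by apply: fm; exists C.
  + by apply/measurable_EFinP; case: (f01 m).
  + by move=> x; rewrite lee_fin; case: (f01 m) => _ /(_ x)/andP[].
- move=> f f1.
  have /choice[A /choice[B AB]] i : exists A, exists B,
      [/\ measurable A, measurable B & f i = \1_(A `*` B)].
    by have /= [_ [A mA [B mB ->]] ->] := f1 i; exists A, B.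
  have mA i : measurable (A i) by have [] := AB i.
  have mB i : measurable (B i) by have [] := AB i.
  have {AB}-> : f = fun i => \1_(A i `*` B i) by apply/funext => i; have [] := AB i.
  pose EA := \bigcap_(i : 'I_n) X i @^-1` A i.
  pose EB := \bigcap_(i : 'I_n) Th i @^-1` B i.
  have mEA : measurable EA.
    by apply: fin_bigcap_measurable => // i _; rewrite -[X in measurable X]setTI; exact: mX.
  have mEB : measurable EB.
    by apply: fin_bigcap_measurable => // i _; rewrite -[X in measurable X]setTI; exact: mTh.
  pose c := \prod_(i < n) fine (U (B i)).
  have prod_indic m (C : 'I_m -> set Omega) w :
      \prod_i \1_(C i) w = \1_(\bigcap_i C i) w :> R.
    have [Cw|/existsNP[i Ciw]] := pselect (forall i, C i w).
      rewrite big1 => [|i _]; last by rewrite indicE mem_set.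
      by rewrite indicE mem_set// => i _; exact: Cw.
    rewrite (bigD1 i)//= !indicE (memNset Ciw) mul0r memNset//.
    by move=> /(_ i I).
  transitivity (P (EA `&` EB)).
    rewrite -[X in P X]setIT -integral_indic//; last exact: measurableI.
    apply: eq_integral => w _; congr EFin.
    rewrite indicI/= -!prod_indic -big_split/=; apply: eq_bigr => i _.
    have mem_preimage T (g : Omega -> T) (C : set T) : (w \in g @^-1` C) = (g w \in C) by [].
    rewrite !indicE in_setX/= !mem_preimage.
    by case: (_ \in A i); case: (_ \in B i); rewrite ?mulr0 ?mul0r ?mulr1.
  rewrite XTh; [|exact: generated_by_seq_bigcap|exact: generated_by_seq_bigcap].
  rewrite probability_marks// prode_fine; last by move=> i; exact: fin_num_measure.
  rewrite -/c -[X in P X]setIT -integral_indic// -ge0_integralZr//; last 2 first.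
  - by apply/measurable_EFinP; exact: measurable_indic.
  - by rewrite lee_fin; apply: prodr_ge0 => i _; exact: fine_ge0.
  apply: eq_integral => w _; rewrite -EFinM; congr EFin.
  rewrite -prod_indic -big_split/=; apply: eq_bigr => i _.
  by rewrite mark_mean_rectangle.
Qed.

End marks.

(** * Monotone limits and powers with a cardinal exponent *)

Section limits.
Context (R : realType).

(** Both iterated limits are the infimum of the double sequence. *)
Lemma nonincreasing_double_limit (a : nat -> nat -> R) (b c : nat -> R) (l : R) :
  (forall n, nonincreasing_seq (a n)) ->
  (forall N, nonincreasing_seq (a ^~ N)) ->
  (forall n, a n N @[N --> \oo] --> c n) ->
  (forall N, a n N @[n --> \oo] --> b N) ->
  c @ \oo --> l -> b @ \oo --> l.
Proof.
move=> aN an ac ab cl.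
have c_le n N : c n <= a n N.
  by rewrite -(cvg_lim _ (ac n))//; apply: nonincreasing_cvgn_ge => //; apply/cvg_ex; exists (c n); exact: ac.
have b_le n N : b N <= a n N.
  by rewrite -(cvg_lim _ (ab N))//; apply: (nonincreasing_cvgn_ge (an N)); apply/cvg_ex; exists (b N); exact: ab.
have l_le N : l <= b N.
  apply: (ler_cvg_to cl (ab N)); apply: nearW => n; exact: c_le.
apply/cvgrPdist_lt => e e0.
have e20 : 0 < e / 2 by rewrite divr_gt0.
have /cvgrPdist_lt/(_ _ e20)[n _ cn] := cl.
have {}cn := cn n (leqnn n).
have /cvgrPdist_lt/(_ _ e20) acn := ac n.
near=> N; have aN2 : `|c n - a n N| < e / 2 by near: N.
rewrite distrC ger0_norm ?subr_ge0//.
have := b_le n N; move: cn aN2; rewrite !ltr_norml => /andP[? ?] /andP[? ?]; lra.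
Unshelve. all: by end_near. Qed.

Definition ncount (E : set nat) (n : nat) : nat := \sum_(j < n) (val j \in E).

Lemma ncountS E n : ncount E n.+1 = (ncount E n + (n \in E))%N.
Proof. by rewrite /ncount big_ord_recr. Qed.

Lemma ncount_le E n : (ncount E n <= n)%N.
Proof.
elim: n => [|n IH]; first by rewrite /ncount big_ord0.
by rewrite ncountS -addn1 leq_add// leq_b1.
Qed.

Lemma nondecreasing_ncount E : {homo ncount E : m n / (m <= n)%N}.
Proof.
apply: homo_leq => //; first exact: leq_trans.
by move=> n; rewrite ncountS leq_addr.
Qed.

Lemma subset_ncount E F n : E `<=` F -> (ncount E n <= ncount F n)%N.
Proof.
move=> EF; apply: leq_sum => j _; case: (boolP (val j \in E)) => // jE.
by rewrite mem_set//; apply: EF; exact/set_mem.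
Qed.

Lemma counting_series (E : set nat) :
  counting E = (\sum_(n <oo) (n \in E)%:R%:E)%E :> \bar R.
Proof. by rewrite counting_dirac; apply: eq_eseriesr => n _; rewrite diracE. Qed.

Lemma cvg_ncount (E : set nat) :
  (ncount E n)%:R%:E @[n --> \oo] --> (counting E : \bar R).
Proof.
rewrite counting_series (_ : (fun n => _) = fun n => (\sum_(0 <= k < n) (k \in E)%:R%:E)%E).
  by apply: is_cvg_nneseries => n _ _; rewrite lee_fin.
by apply/funext => n; rewrite sumEFin -natr_sum big_mkord.
Qed.

(** This is r to the power of the cardinal of E, and 0 when E is infinite and
    r < 1. As a limit of finite powers it is measurable in random sets E. *)
Definition pow_card (r : R) (E : set nat) : R := limn (fun n => r ^+ ncount E n).

Section pow_card.
Variables (r : R) (E : set nat).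
Hypothesis r01 : 0 <= r <= 1.

Lemma nonincreasing_pow_ncount : nonincreasing_seq (fun n => r ^+ ncount E n).
Proof.
move=> m n mn; have /andP[r0 r1] := r01.
by apply: ler_wiXn2l => //; exact: nondecreasing_ncount.
Qed.

Lemma cvg_pow_card : r ^+ ncount E n @[n --> \oo] --> pow_card r E.
Proof.
apply: nonincreasing_is_cvgn; first exact: nonincreasing_pow_ncount.
by exists 0 => _ [n _ <-]; apply: exprn_ge0; case/andP: r01.
Qed.

Lemma pow_card_le n : pow_card r E <= r ^+ ncount E n.
Proof.
apply: nonincreasing_cvgn_ge; first exact: nonincreasing_pow_ncount.
exact: cvg_pow_card.
Qed.

Lemma pow_card_ge0 : 0 <= pow_card r E.
Proof.
apply: limr_ge; first exact: cvg_pow_card.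
by apply: nearW => n; apply: exprn_ge0; case/andP: r01.
Qed.

Lemma pow_card_le1 : pow_card r E <= 1.
Proof. by apply: (le_trans (pow_card_le 0)); rewrite /ncount big_ord0 expr0. Qed.

End pow_card.

Lemma counting_nat_ncount (E : set nat) m : counting E = m%:R%:E :> \bar R ->
  \forall n \near \oo, ncount E n = m.
Proof.
move=> Em; have := @cvg_ncount E; rewrite Em => /fine_cvgP[_ /=].
move=> /cvgrPdist_lt /(_ 1 ltr01); apply: filterS => n /=.
rewrite ltr_norml => {Em} /andP[h1 h2].
have [nm|mn|//] := ltngtP (ncount E n) m.
- have : (ncount E n).+1%:R <= m%:R :> R by rewrite ler_nat.
  by rewrite -natr1 => h; exfalso; lra.
- have : m.+1%:R <= (ncount E n)%:R :> R by rewrite ler_nat.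
  by rewrite -natr1 => h; exfalso; lra.
Qed.

Lemma pow_card_nat (r : R) (E : set nat) m : counting E = m%:R%:E :> \bar R ->
  pow_card r E = r ^+ m.
Proof.
move=> /counting_nat_ncount Em; apply: cvg_lim => //.
apply: cvg_near_cst; apply: filterS Em => n -> //.
Qed.

Lemma counting_infinite (E : set nat) : infinite_set E -> counting E = +oo%E :> \bar R.
Proof. by move=> iE; rewrite /counting asboolF. Qed.

Lemma counting_finite (E : set nat) : finite_set E ->
  exists m, counting E = m%:R%:E :> \bar R.
Proof. by move=> fE; eexists; rewrite /counting asboolT. Qed.

Lemma pow_card_infinite (r : R) (E : set nat) : 0 <= r < 1 -> infinite_set E ->
  pow_card r E = 0.
Proof.
move=> /andP[r0 r1] /counting_infinite iE.
have := @cvg_ncount E; rewrite iE => /cvgeyPge h.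
have r01 : 0 <= r <= 1 by rewrite r0 ltW.
apply/eqP; rewrite eq_le pow_card_ge0// andbT.
have : r ^+ m @[m --> \oo] --> 0 by apply: cvg_expr; rewrite ger0_norm.
move=> r_cvg; rewrite -(cvg_lim _ r_cvg)//; apply: limr_ge; first exact: (cvgP _ r_cvg).
apply: nearW => m.
have [n _ /(_ n (leqnn n)) mn] := h m%:R.
apply: (le_trans (pow_card_le E r01 n)); apply: ler_wiXn2l => //; first exact: ltW.
by move: mn; rewrite /= lee_fin ler_nat.
Qed.

End limits.

(** * The generating functional of a Poisson process *)

Section bounded_convergence.
Context d (T : measurableType d) (R : realType) (P : probability T R).

Lemma measurable_fun_limit (f_ : nat -> T -> R) (f : T -> R) :
  (forall n, measurable_fun setT (f_ n)) ->
  (forall x, f_ n x @[n --> \oo] --> f x) -> measurable_fun setT f.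
Proof. by move=> mf_ cf; apply: (measurable_fun_cvg mf_) => x _; exact: cf. Qed.

Lemma unit_interval_valued_limit (f_ : nat -> T -> R) (f : T -> R) :
  (forall n, unit_interval_valued (f_ n)) ->
  (forall x, f_ n x @[n --> \oo] --> f x) -> unit_interval_valued f.
Proof.
move=> f01 cf; split; first by apply: (measurable_fun_limit _ cf) => n; case: (f01 n).
move=> x; rewrite -(cvg_lim _ (cf x))//; apply/andP; split.
  apply: limr_ge; first exact: (cvgP _ (cf x)).
  by apply: nearW => n; case: (f01 n) => _ /(_ x)/andP[].
apply: limr_le; first exact: (cvgP _ (cf x)).
by apply: nearW => n; case: (f01 n) => _ /(_ x)/andP[].
Qed.

Lemma bounded_convergence (f_ : nat -> T -> R) (f : T -> R) :
  (forall n, unit_interval_valued (f_ n)) ->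
  (forall x, f_ n x @[n --> \oo] --> f x) ->
  (\int[P]_x (f_ n x)%:E)%E @[n --> \oo] --> (\int[P]_x (f x)%:E)%E.
Proof.
move=> f01 cf.
have [|||||_ _] := @dominated_convergence _ _ _ P setT measurableT
  (fun n x => (f_ n x)%:E) (EFin \o f) (cst 1%E).
- by move=> n; apply/measurable_EFinP; case: (f01 n).
- by apply/measurable_EFinP; case: (unit_interval_valued_limit f01 cf).
- by apply: aeW => x _; apply: cvg_EFin; [exact: nearW|exact: cf].
- exact: finite_measure_integrable_cst.
- apply: aeW => x n _; rewrite lee_fin ger0_norm.
  + by case: (f01 n) => _ /(_ x)/andP[].
  + by case: (f01 n) => _ /(_ x)/andP[].
by [].
Qed.

End bounded_convergence.

Section poisson_law.
Context (R : realType).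
Implicit Types (m s : R).

(** This is s to the power x when x is a natural number, and 0 otherwise. The
    series makes it measurable in x. *)
Definition power_at (s : R) (x : \bar R) : R :=
  fine (\sum_(n <oo) ((s ^+ n)%:E * (\1_[set n%:R%:E] x)%:E))%E.

Let power_at_series_nat (s : R) n : 0 <= s ->
  (\sum_(m <oo) ((s ^+ m)%:E * (\1_[set m%:R%:E] (n%:R%:E : \bar R))%:E))%E =
  (s ^+ n)%:E.
Proof.
move=> s0; rewrite (nneseriesD1 (n := n))//; last first.
  by move=> k _; rewrite mule_ge0// lee_fin ?exprn_ge0.
rewrite eseries0 ?adde0 => [|k _ /= kn].
  by rewrite indicE mem_set// mule1.
rewrite indicE memNset ?mule0//= => -[] /eqP.
by rewrite eqr_nat eq_sym (negbTE kn).
Qed.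

Let power_at_series0 (s : R) (x : \bar R) : (forall n, x <> n%:R%:E) ->
  (\sum_(n <oo) ((s ^+ n)%:E * (\1_[set n%:R%:E] x)%:E))%E = 0%E.
Proof. by move=> xn; rewrite eseries0// => n _ _; rewrite indicE memNset ?mule0//; exact: xn. Qed.

Lemma power_at_nat (s : R) n : 0 <= s -> power_at s n%:R%:E = s ^+ n.
Proof. by move=> s0; rewrite /power_at power_at_series_nat. Qed.

Lemma power_at_non_nat (s : R) x : (forall n, x <> n%:R%:E) -> power_at s x = 0.
Proof. by move=> xn; rewrite /power_at power_at_series0. Qed.

Lemma power_atE (s : R) (x : \bar R) : 0 <= s ->
  (power_at s x)%:E = (\sum_(n <oo) ((s ^+ n)%:E * (\1_[set n%:R%:E] x)%:E))%E.
Proof.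
move=> s0; have [[n ->]|/forallNP xn] := pselect (exists n, x = n%:R%:E).
  by rewrite power_at_series_nat// power_at_nat.
by rewrite power_at_series0// power_at_non_nat.
Qed.

Lemma power_at_counting (s : R) (E : set nat) : 0 <= s < 1 ->
  power_at s (counting E) = pow_card s E.
Proof.
move=> /andP[s0 s1]; have [fE|iE] := pselect (finite_set E).
  have [m Em] := counting_finite R fE.
  by rewrite Em power_at_nat// (pow_card_nat s Em).
by rewrite counting_infinite// power_at_non_nat// pow_card_infinite// s0.
Qed.

Lemma poisson_prob_set1 m n : 0 <= m ->
  poisson_prob m 0 [set n] = (m ^+ n / n`!%:R * expR (- m))%:E.
Proof.
rewrite le_eqVlt => /predU1P[<-|m0]; rewrite /poisson_prob.
  rewrite ltxx oppr0 expR0 mulr1 diracE expr0n.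
  case: n => [|n]; first by rewrite mem_set//= fact0 divr1.
  by rewrite memNset//= mul0r.
by rewrite m0 esum_set1 /poisson_pmf m0// lee_fin !mulr_ge0// ?expR_ge0 ?exprn_ge0 ?ltW.
Qed.

Lemma poisson_pgf m s : 0 <= m -> 0 <= s ->
  (\sum_(n <oo) ((s ^+ n)%:E * poisson_prob m 0 [set n]))%E =
  (expR (- ((1 - s) * m)))%:E.
Proof.
move=> m0 s0.
have H : series (exp_coeff (s * m)) n @[n --> \oo] --> expR (s * m).
  exact: is_cvg_series_exp_coeff.
apply: cvg_lim => //.
rewrite (_ : (fun n => _) = EFin \o (fun n => series (exp_coeff (s * m)) n * expR (- m))).
  apply: cvg_EFin; first exact: nearW.
  rewrite (_ : - ((1 - s) * m) = s * m + - m); last by ring.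
  rewrite expRD; apply: cvgM; [exact: H|exact: cvg_cst].
apply/funext => n /=; rewrite /series/= mulr_suml -sumEFin; apply: eq_bigr => i _.
rewrite poisson_prob_set1// -EFinM; congr EFin.
by rewrite /exp_coeff/= exprMn !mulrA.
Qed.

End poisson_law.

Section poisson_process.
Context d (Omega : measurableType d) (R : realType) (P : probability Omega R).
Context dT (T : measurableType dT) (nu : {measure set T -> \bar R}).
Variable X : nat -> Omega -> T.
Hypothesis mX : forall i, measurable_fun setT (X i).

Definition count_in (B : set T) (w : Omega) : \bar R :=
  counting [set i | B (X i w)].

Hypothesis count_law : forall (B : set T) n, measurable B -> (nu B < +oo)%E ->
  P [set w | count_in B w = n%:R%:E] = poisson_prob (fine (nu B)) 0 [set n].
Hypothesis count_indep : forall k (B : 'I_k -> set T),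
  (forall i, measurable (B i)) -> trivIset setT B ->
  independent_rvs P (fun i => count_in (B i)).

Lemma measurable_preimage_rv (B : set T) i : measurable B ->
  measurable [set w | B (X i w)].
Proof. by move=> mB; rewrite -[X in measurable X]setTI; exact: mX. Qed.

Lemma measurable_count_in (B : set T) : measurable B ->
  measurable_fun setT (count_in B).
Proof.
move=> mB; rewrite (_ : count_in B = fun w => (\sum_(n <oo) (\1_[set w | B (X n w)] w)%:E)%E).
  apply: ge0_emeasurable_sum => // n _.
  apply/measurable_EFinP; apply: measurable_indic.
  exact: measurable_preimage_rv.
apply/funext => w; rewrite /count_in counting_series; apply: eq_eseriesr => n _.
by rewrite indicE; congr (_ %:R%:E); apply/idP/idP => /set_mem h; exact/mem_set.
Qed.

Lemma unit_interval_valued_power_at (s : R) : 0 <= s <= 1 -> unit_interval_valued (power_at s).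
Proof.
move=> s01; split.
  apply: measurableT_comp => //.
  apply: ge0_emeasurable_sum => [n x _ _|n _].
    by rewrite mule_ge0// lee_fin ?exprn_ge0//; case/andP: s01.
  apply: measurable_funeM; apply/measurable_EFinP; apply: measurable_indic.
  exact: emeasurable_set1.
move=> x; have [[n ->]|/forallNP nx] := pselect (exists n, x = n%:R%:E).
  by case/andP: s01 => s0 s1; rewrite power_at_nat// exprn_ge0//= exprn_ile1.
by rewrite power_at_non_nat// lexx ler01.
Qed.

Lemma expectation_power_count (B : set T) (s : R) : measurable B ->
  (nu B < +oo)%E -> 0 <= s <= 1 ->
  (\int[P]_w (power_at s (count_in B w))%:E)%E =
  (expR (- ((1 - s) * fine (nu B))))%:E.
Proof.
move=> mB nuB s01; have [ms s01'] := unit_interval_valued_power_at s01.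
have mN n : measurable [set w | count_in B w = n%:R%:E].
  have := measurable_count_in mB measurableT (emeasurable_set1 n%:R%:E).
  by rewrite setTI.
have s0 : 0 <= s by case/andP: s01.
rewrite -poisson_pgf//.
transitivity (\int[P]_w (\sum_(n <oo)
    ((s ^+ n)%:E * (\1_[set w | count_in B w = n%:R%:E] w)%:E)))%E.
  by apply: eq_integral => w _; rewrite power_atE.
rewrite integral_nneseries//; last 2 first.
- move=> n; apply: measurable_funeM; apply/measurable_EFinP; apply: measurable_indic; exact: mN.
- by move=> n w _; rewrite mule_ge0// lee_fin exprn_ge0.
apply: eq_eseriesr => n _; rewrite ge0_integralZl ?lee_fin ?exprn_ge0//; last first.
  by apply/measurable_EFinP; apply: measurable_indic; exact: mN.
rewrite integral_indic//. rewrite setIT; congr (_ * _)%E. exact: count_law.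
Qed.

(** Counts in disjoint sets are independent, so the generating function of a
    finite family of them factorizes. *)
Lemma expectation_pow_cards k (B : 'I_k -> set T) (s : 'I_k -> R) :
  (forall i, measurable (B i)) -> trivIset setT B -> (forall i, nu (B i) < +oo)%E ->
  (forall i, 0 <= s i < 1) ->
  (\int[P]_w (\prod_i pow_card (s i) [set j | B i (X j w)])%:E)%E =
  (expR (- (\sum_i (1 - s i) * fine (nu (B i)))))%:E.
Proof.
move=> mB tB nuB s01.
have s01' i : 0 <= s i <= 1 by have /andP[-> /ltW] := s01 i.
transitivity (\int[P]_w (\prod_i power_at (s i) (count_in (B i) w))%:E)%E.
  apply: eq_integral => w _; congr EFin; apply: eq_bigr => i _.
  by rewrite power_at_counting.
rewrite (expectation_prod_independent (f := fun i => power_at (s i)))//; last 3 first.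
- by move=> i; exact: measurable_count_in.
- exact: count_indep.
- by move=> i; exact: unit_interval_valued_power_at.
rewrite -sumrN expR_sum -prodEFin; apply: eq_bigr => i _.
by rewrite expectation_power_count.
Qed.

End poisson_process.

Section generating_functional.
Context d (Omega : measurableType d) (R : realType) (P : probability Omega R).
Context dT (T : measurableType dT) (nu : {measure set T -> \bar R}).
Variable X : nat -> Omega -> T.
Hypothesis mX : forall i, measurable_fun setT (X i).

Lemma unit_interval_valued_onem d' (T' : measurableType d') (q : T' -> R) :
  unit_interval_valued q -> unit_interval_valued (fun x => 1 - q x).
Proof.
move=> [mq q01]; split; first exact: measurable_funB.
by move=> x; have /andP[q0 q1] := q01 x; rewrite subr_ge0 q1 gerBl.
Qed.

Lemma unit_interval_valued_survival (q : T -> R) n : unit_interval_valued q ->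
  unit_interval_valued (fun w => \prod_(j < n) (1 - q (X j w))).
Proof.
move=> q01; apply: unit_interval_valued_prod => j.
exact: (unit_interval_valued_comp (mX j) (unit_interval_valued_onem q01)).
Qed.

Lemma prod_pow_ncount (E : set nat) (s : R) n :
  \prod_(j < n) s ^+ (val j \in E) = s ^+ ncount E n.
Proof. by rewrite /ncount expr_sum. Qed.

(** The factors are grouped by the value of h, which leaves one power of
    1 - y for the count of the points where h takes the value y. *)
Lemma generating_functional_nnsfun (h : {nnsfun T >-> R}) :
  (forall k (B : 'I_k -> set T) (s : 'I_k -> R),
    (forall i, measurable (B i)) -> trivIset setT B -> (forall i, nu (B i) < +oo)%E ->
    (forall i, 0 <= s i < 1) ->
    (\int[P]_w (\prod_i pow_card (s i) [set j | B i (X j w)])%:E)%E =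
    (expR (- (\sum_i (1 - s i) * fine (nu (B i)))))%:E) ->
  (forall x, h x <= 1) -> (\int[nu]_x (h x)%:E < +oo)%E ->
  (\int[P]_w (\prod_(j < n) (1 - h (X j w)))%:E)%E @[n --> \oo] -->
  (expR (- fine (\int[nu]_x (h x)%:E)%E))%:E.
Proof.
move=> pgf h1 hoo.
(* The value 0 is left out: its level set may have infinite measure, and its
   factors are 1. *)
pose s := [seq y <- fset_set (range h) | y != 0].
have us : uniq s by rewrite filter_uniq// fset_uniq.
pose k := size s; pose y (i : 'I_k) := nth 0 s i.
pose B i := h @^-1` [set y i].
have ys i : y i \in s by exact: mem_nth (ltn_ord i).
have y01 i : 0 < y i <= 1.
  have := ys i; rewrite mem_filter => /andP[yi0].
  rewrite in_fset_set// inE => -[x _ hx].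
  by rewrite lt_neqAle eq_sym yi0 -hx h1 fun_ge0.
have mB i : measurable (B i) by exact: measurable_sfunP.
have tB : trivIset setT B.
  move=> i j _ _ [x [/= hi hj]]; apply/val_inj/eqP.
  rewrite -(nth_uniq 0 (ltn_ord i) (ltn_ord j) us); apply/eqP.
  exact: (etrans (esym hi) hj).
have hE x : h x = \sum_i y i * \1_(B i) x.
  have [hx0|hx0] := eqVneq (h x) 0.
    rewrite hx0 big1// => i _; rewrite indicE memNset ?mulr0// /B/= hx0 => yi.
    by have := y01 i; rewrite -yi ltxx.
  have hxs : h x \in s by rewrite mem_filter hx0/= in_fset_set// inE; exists x.
  pose i0 := Ordinal (etrans (index_mem (h x) s) hxs).
  have yi0 : y i0 = h x by rewrite /y/= nth_index.
  rewrite (bigD1 i0)//= big1 ?addr0.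
    by rewrite indicE mem_set ?mulr1.
  move=> i ii0; rewrite indicE memNset ?mulr0// /B/= -yi0 => /eqP.
  by rewrite (nth_uniq 0 (ltn_ord i0) (ltn_ord i) us) => /eqP/esym/val_inj/eqP; rewrite (negbTE ii0).
have oneE x : 1 - h x = \prod_i (1 - y i) ^+ (x \in B i).
  have [hx0|hx0] := eqVneq (h x) 0.
    rewrite hx0 subr0 big1// => i _; rewrite memNset// /B/= hx0 => yi.
    by have := y01 i; rewrite -yi ltxx.
  have hxs : h x \in s by rewrite mem_filter hx0/= in_fset_set// inE; exists x.
  pose i0 := Ordinal (etrans (index_mem (h x) s) hxs).
  have yi0 : y i0 = h x by rewrite /y/= nth_index.
  rewrite (bigD1 i0)//= big1 ?mulr1.
    by rewrite mem_set ?expr1 ?yi0.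
  move=> i ii0; rewrite memNset// /B/= -yi0 => /eqP.
  by rewrite (nth_uniq 0 (ltn_ord i0) (ltn_ord i) us) => /eqP/esym/val_inj/eqP; rewrite (negbTE ii0).
have intE : (\int[nu]_x (h x)%:E = \sum_i (y i)%:E * nu (B i))%E.
  under eq_integral do rewrite hE -sumEFin.
  rewrite ge0_integral_sum//=; last 2 first.
  - move=> i; apply/measurable_EFinP; apply: measurable_funM; first exact: measurable_cst.
    apply: measurable_indic; exact: mB.
  - by move=> i x _; rewrite lee_fin mulr_ge0//; case/andP: (y01 i) => /ltW.
  apply: eq_bigr => i _.
  under eq_integral do rewrite EFinM.
  rewrite ge0_integralZl//; last 2 first.
  - by apply/measurable_EFinP; apply: measurable_indic; exact: mB.
  - by rewrite lee_fin; case/andP: (y01 i) => /ltW.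
  by rewrite integral_indic// setIT.
have nuB i : (nu (B i) < +oo)%E.
  rewrite ltey; apply/eqP => Boo; move: hoo; rewrite intE (bigD1 i)//= Boo.
  rewrite gt0_muley ?lte_fin; last by case/andP: (y01 i).
  rewrite addye ?ltxx// -ltNye (lt_le_trans ltNy0)//.
  by apply: sume_ge0 => j _; rewrite mule_ge0// lee_fin; case/andP: (y01 j) => /ltW.
have s01 i : 0 <= 1 - y i < 1.
  by have /andP[y0 y1] := y01 i; rewrite subr_ge0 y1/= gtrBl.
have -> : - fine (\int[nu]_x (h x)%:E)%E = - (\sum_i (1 - (1 - y i)) * fine (nu (B i))).
  congr (- _); rewrite intE.
  under eq_bigr do rewrite -(fineK (x := nu _)) ?ge0_fin_numE// -EFinM.
  by rewrite sumEFin/=; apply: eq_bigr => i _; rewrite subKr.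
rewrite -(pgf _ B (fun i => 1 - y i))//.
apply: bounded_convergence => [n|w].
  apply: unit_interval_valued_survival; split=> //.
  by move=> x; rewrite h1 fun_ge0.
rewrite (_ : (fun n => _) = fun n => \prod_i (1 - y i) ^+ ncount [set j | B i (X j w)] n).
  apply: cvg_big => [|i _]; first exact: mul_continuous.
  apply: cvg_pow_card.
  by have /andP[-> /ltW] := s01 i.
apply/funext => n; under [LHS]eq_bigr do rewrite oneE.
rewrite exchange_big/=; apply: eq_bigr => i _; rewrite -prod_pow_ncount.
exact: eq_bigr.
Qed.


Lemma fine_integral_unit (f : Omega -> R) : unit_interval_valued f ->
  (fine (\int[P]_w (f w)%:E))%:E = (\int[P]_w (f w)%:E)%E.
Proof. by move=> f01; rewrite fineK//; exact: integral_unit_fin_num. Qed.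

Lemma le_fine_integral_unit (f g : Omega -> R) :
  unit_interval_valued f -> unit_interval_valued g -> (forall w, f w <= g w) ->
  fine (\int[P]_w (f w)%:E)%E <= fine (\int[P]_w (g w)%:E)%E.
Proof.
move=> f01 g01 fg; rewrite -lee_fin !fine_integral_unit//.
have [mf f0] := f01; have [mg g0] := g01.
apply: ge0_le_integral => //.
- by move=> w _; rewrite lee_fin; case/andP: (f0 w).
- exact/measurable_EFinP.
- exact/measurable_EFinP.
- by move=> w _; rewrite lee_fin.
Qed.

Lemma cvg_fine_integral_unit (f_ : nat -> Omega -> R) (f : Omega -> R) :
  (forall n, unit_interval_valued (f_ n)) ->
  (forall w, f_ n w @[n --> \oo] --> f w) ->
  fine (\int[P]_w (f_ n w)%:E)%E @[n --> \oo] --> fine (\int[P]_w (f w)%:E)%E.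
Proof.
move=> f01 cf; apply: fine_cvg; rewrite fine_integral_unit.
  exact: bounded_convergence.
exact: (unit_interval_valued_limit f01 cf).
Qed.

Hypothesis count_law : forall (B : set T) n, measurable B -> (nu B < +oo)%E ->
  P [set w | count_in R X B w = n%:R%:E] = poisson_prob (fine (nu B)) 0 [set n].
Hypothesis count_indep : forall k (B : 'I_k -> set T),
  (forall i, measurable (B i)) -> trivIset setT B ->
  independent_rvs P (fun i => count_in R X (B i)).

(** Along simple functions increasing to q, the products decrease both in the
    number of factors and in the approximation, so that the two limits can be
    exchanged. *)
Lemma generating_functional_poisson (q : T -> R) : unit_interval_valued q ->
  (\int[nu]_x (q x)%:E < +oo)%E ->
  (\int[P]_w (\prod_(j < n) (1 - q (X j w)))%:E)%E @[n --> \oo] -->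
  (expR (- fine (\int[nu]_x (q x)%:E)%E))%:E.
Proof.
move=> q01 qoo; have [mq q01'] := q01.
have mq' : measurable_fun setT (EFin \o q) by exact/measurable_EFinP.
have q0 x : (0 <= (EFin \o q) x)%E by rewrite lee_fin; case/andP: (q01' x).
pose h := nnsfun_approx measurableT mq'.
have hcvg x : h n x @[n --> \oo] --> q x.
  have hx : (h n x)%:E @[n --> \oo] --> (q x)%:E.
    by apply: (cvg_nnsfun_approx measurableT mq') => // y _; exact: q0.
  exact: fine_cvg hx.
have hnd x : nondecreasing_seq (h ^~ x).
  by move=> m n mn; exact/lefP/nd_nnsfun_approx.
have hq n x : h n x <= q x.
  rewrite -(cvg_lim _ (hcvg x))//; apply: nondecreasing_cvgn_le; first exact: hnd.
  exact: (cvgP _ (hcvg x)).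
have h01 n : unit_interval_valued (h n).
  by split => // x; rewrite fun_ge0 (le_trans (hq n x))//; case/andP: (q01' x).
have hle n : (\int[nu]_x (h n x)%:E <= \int[nu]_x (q x)%:E)%E.
  apply: ge0_le_integral => //.
  - by move=> x _; rewrite lee_fin.
  - exact/measurable_EFinP.
  - by move=> x _; rewrite lee_fin.
have hoo n : (\int[nu]_x (h n x)%:E < +oo)%E by exact: le_lt_trans qoo.
pose surv (f : T -> R) N w := \prod_(j < N) (1 - f (X j w)).
pose a n N := fine (\int[P]_w (surv (h n) N w)%:E)%E.
pose b N := fine (\int[P]_w (surv q N w)%:E)%E.
have h01w (f : T -> R) x : unit_interval_valued f -> 0 <= 1 - f x <= 1.
  by move=> f01; case: (unit_interval_valued_onem f01) => _; exact.
suff : b @ \oo --> expR (- fine (\int[nu]_x (q x)%:E)%E).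
  move=> bq; rewrite (_ : (fun n => _) = EFin \o b).
    by apply: cvg_EFin => //; exact: nearW.
  apply/funext => n; rewrite /= fine_integral_unit//.
  exact: unit_interval_valued_survival.
apply: (@nonincreasing_double_limit _ a b (fun n => expR (- fine (\int[nu]_x (h n x)%:E)%E))).
- move=> n M N MN; apply: le_fine_integral_unit; [exact: unit_interval_valued_survival..|].
  move=> w; rewrite /surv -(subnKC MN) big_split_ord/=.
  apply: ler_piMr; first by apply: prodr_ge0 => i _; have /andP[] := h01w _ (X i w) (h01 n).
  by apply: prodr_ile1 => i _; exact: h01w.
- move=> N m n mn; apply: le_fine_integral_unit; [exact: unit_interval_valued_survival..|].
  move=> w; apply: ler_prod => j _; have /andP[-> _]/= := h01w _ (X j w) (h01 n).
  by rewrite lerD2l lerN2; exact: hnd.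
- move=> n; apply: fine_cvg; apply: generating_functional_nnsfun => //.
    by move=> k B s mB tB nuB s01; exact: expectation_pow_cards.
  by move=> x; case: (h01 n) => _ /(_ x)/andP[].
- move=> N; apply: cvg_fine_integral_unit.
    by move=> n; exact: unit_interval_valued_survival.
  move=> w; apply: cvg_big => [|j _]; first exact: mul_continuous.
  by apply: cvgB; [exact: cvg_cst|exact: hcvg].
- apply: continuous_cvg; first exact: continuous_expR.
  apply: cvgN; apply: fine_cvg; rewrite fineK; last first.
    by rewrite ge0_fin_numE//; apply: integral_ge0 => x _; exact: q0.
  rewrite (_ : (\int[nu]_x (q x)%:E)%E = (\int[nu]_x (limn (fun n => (h n x)%:E)))%E).
    apply: cvg_monotone_convergence => //.
    + by move=> n; exact/measurable_EFinP.
    + by move=> n x _; rewrite lee_fin.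
    + by move=> x _ m n mn; rewrite lee_fin; exact: hnd.
  apply: eq_integral => x _; apply/esym/cvg_lim => //.
  by apply: cvg_EFin; [exact: nearW|exact: hcvg].
Qed.

End generating_functional.

(** * From generating functionals to expected sums over the points *)

Section real_inequalities.
Context (R : realType).
Implicit Types (x y e K : R).

Lemma ler_linear_error x y K : 0 <= K ->
  (forall e, 0 < e <= 1 -> x <= y + e * K) -> x <= y.
Proof.
move=> K0 h; rewrite leNgt; apply/negP => yx.
have K1 : 0 < K + 1 by rewrite ltr_wpDl.
pose e := Num.min 1 ((x - y) / (K + 1)).
have e0 : 0 < e by rewrite lt_min ltr01 divr_gt0// subr_gt0.
have := h e; rewrite e0 ge_min lexx/= => /(_ isT).
have : e * (K + 1) <= x - y.
  by rewrite -ler_pdivlMr// ge_min lexx orbT.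
by rewrite mulrDr mulr1; lra.
Qed.

Lemma onem_expr_le e k : 0 <= e <= 1 -> 1 - (1 - e) ^+ k <= e * k%:R.
Proof.
move=> /andP[e0 e1]; elim: k => [|k IH]; first by rewrite expr0 subrr mulr0.
rewrite exprS -natr1.
have p1 : (1 - e) ^+ k <= 1 by rewrite exprn_ile1 ?subr_ge0 ?gerBl.
have p0 : 0 <= (1 - e) ^+ k by rewrite exprn_ge0// subr_ge0.
nra.
Qed.

Lemma onem_expr_ge e k : 0 <= e <= 1 ->
  e * k%:R <= 1 - (1 - e) ^+ k + k%:R ^+ 2 * e ^+ 2.
Proof.
move=> e01; have /andP[e0 e1] := e01; elim: k => [|k IH].
  by rewrite expr0 subrr mulr0 expr0n/= mul0r addr0.
rewrite exprS -natr1.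
have := onem_expr_le k e01.
have : 0 <= k%:R :> R by [].
nra.
Qed.

Lemma onem_expRN_le x : 1 - expR (- x) <= x.
Proof. by have := expR_ge1Dx (- x); lra. Qed.

Lemma onem_expRN_ge x : 0 <= x -> x - x ^+ 2 <= 1 - expR (- x).
Proof.
move=> x0; have h := expR_ge1Dx x.
have : expR (- x) * expR x = 1 by rewrite expRN mulVf// gt_eqF// expR_gt0.
have := expR_gt0 (- x).
nra.
Qed.

End real_inequalities.

Section campbell.
Context d (Omega : measurableType d) (R : realType) (P : probability Omega R).
Context dS (S : measurableType dS) (mu : {measure set S -> \bar R}).
Variable Z : nat -> Omega -> S.
Hypothesis mZ : forall i, measurable_fun setT (Z i).

Hypothesis generating_functional : forall h : S -> R, unit_interval_valued h ->
  (\int[mu]_z (h z)%:E < +oo)%E ->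
  (\int[P]_w (\prod_(j < n) (1 - h (Z j w)))%:E)%E @[n --> \oo] -->
  (expR (- fine (\int[mu]_z (h z)%:E)%E))%:E.

Definition points_in (D : set S) (w : Omega) : set nat := [set j | D (Z j w)].

Lemma unit_interval_valued_pow_ncount (r : R) D n : measurable D -> 0 <= r <= 1 ->
  unit_interval_valued (fun w => r ^+ ncount (points_in D w) n).
Proof.
move=> mD r01; have /andP[r0 r1] := r01; split; last first.
  by move=> w; rewrite exprn_ge0//= exprn_ile1.
under eq_fun do rewrite -prod_pow_ncount.
apply: measurable_prod => j _.
rewrite (_ : (fun w => _) = fun w => r * \1_D (Z j w) + (1 - \1_D (Z j w))); last first.
  apply/funext => w; rewrite indicE.
  have -> : (val j \in points_in D w) = (Z j w \in D).
    by apply/idP/idP => /set_mem h; exact/mem_set.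
  by case: (_ \in D); rewrite /= ?mulr1 ?mulr0 ?subrr ?subr0 ?addr0 ?add0r ?expr1 ?expr0.
have m1 : measurable_fun setT (fun w => \1_D (Z j w) : R).
  by apply: measurableT_comp => //; exact: measurable_indic.
by apply: measurable_funD; [exact: measurable_funM|exact: measurable_funB].
Qed.

Lemma unit_interval_valued_pow_card (r : R) D : measurable D -> 0 <= r <= 1 ->
  unit_interval_valued (fun w => pow_card r (points_in D w)).
Proof.
move=> mD r01; apply: (@unit_interval_valued_limit _ _ _
  (fun n w => r ^+ ncount (points_in D w) n)).
  by move=> n; exact: unit_interval_valued_pow_ncount.
by move=> w; exact: cvg_pow_card.
Qed.

Lemma unit_interval_valuedM d' (T : measurableType d') (f g : T -> R) :
  unit_interval_valued f -> unit_interval_valued g ->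
  unit_interval_valued (fun x => f x * g x).
Proof.
move=> [mf f01] [mg g01]; split; first exact: measurable_funM.
move=> x; have /andP[f0 f1] := f01 x; have /andP[g0 g1] := g01 x.
by rewrite mulr_ge0//= mulr_ile1.
Qed.

(** The generating functional of a function h with 1 - h equal to s on A, to r
    on D and to 1 elsewhere. *)
Lemma joint_generating_function (A D : set S) (s r : R) :
  measurable A -> measurable D -> A `&` D = set0 ->
  (mu A < +oo)%E -> (mu D < +oo)%E -> 0 <= s <= 1 -> 0 <= r <= 1 ->
  (\int[P]_w (pow_card s (points_in A w) * pow_card r (points_in D w))%:E)%E =
  (expR (- ((1 - s) * fine (mu A) + (1 - r) * fine (mu D))))%:E.
Proof.
move=> mA mD AD0 muA muD s01 r01.
have /andP[s0 s1] := s01; have /andP[r0 r1] := r01.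
pose h z : R := (1 - s) * \1_A z + (1 - r) * \1_D z.
have AD z : (z \in A) && (z \in D) = false.
  apply/negP => /andP[/set_mem Az /set_mem Dz].
  by have : (A `&` D) z by []; rewrite AD0.
have h01 : unit_interval_valued h.
  split.
    by apply: measurable_funD; apply: measurable_funM => //; exact: measurable_indic.
  move=> z; rewrite /h !indicE; have := AD z.
  by case: (z \in A); case: (z \in D) => //= _;
    rewrite ?mulr1 ?mulr0 ?addr0 ?add0r ?subr_ge0 ?gerBl ?s0 ?s1 ?r0 ?r1 ?lexx ?ler01.
have inth : (\int[mu]_z (h z)%:E)%E =
    ((1 - s)%:E * mu A + (1 - r)%:E * mu D)%E.
  rewrite (eq_integral (fun z =>
    (1 - s)%:E * (\1_A z)%:E + (1 - r)%:E * (\1_D z)%:E)%E)//.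
  rewrite ge0_integralD//; last 4 first.
  - by move=> z _; rewrite -EFinM lee_fin mulr_ge0// subr_ge0.
  - by apply: measurable_funeM; apply/measurable_EFinP; exact: measurable_indic.
  - by move=> z _; rewrite -EFinM lee_fin mulr_ge0// subr_ge0.
  - by apply: measurable_funeM; apply/measurable_EFinP; exact: measurable_indic.
  rewrite !ge0_integralZl ?lee_fin ?subr_ge0//; last 2 first.
  - by apply/measurable_EFinP; exact: measurable_indic.
  - by apply/measurable_EFinP; exact: measurable_indic.
  by rewrite !integral_indic// !setIT.
have finA : mu A \is a fin_num by rewrite ge0_fin_numE.
have finD : mu D \is a fin_num by rewrite ge0_fin_numE.
have inth' : (\int[mu]_z (h z)%:E)%E =
    ((1 - s) * fine (mu A) + (1 - r) * fine (mu D))%:E.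
  by rewrite inth [RHS]EFinD !EFinM !fineK.
have := generating_functional h01; rewrite inth' ltry/= => /(_ isT) H.
apply: (cvg_unique _ _ H) => //.
have -> : (fun n => (\int[P]_w (\prod_(j < n) (1 - h (Z j w)))%:E)%E) =
  (fun n => (\int[P]_w ((s ^+ ncount (points_in A w) n) * (r ^+ ncount (points_in D w) n))%:E)%E).
  apply/funext => n; apply: eq_integral => w _; congr EFin.
  rewrite -!prod_pow_ncount -big_split/=; apply: eq_bigr => j _.
  have -> : (val j \in points_in A w) = (Z j w \in A).
    by apply/idP/idP => /set_mem h'; exact/mem_set.
  have -> : (val j \in points_in D w) = (Z j w \in D).
    by apply/idP/idP => /set_mem h'; exact/mem_set.
  rewrite /h !indicE; have := AD (Z j w).
  by case: (_ \in A); case: (_ \in D) => //= _;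
   rewrite ?mulr1 ?mulr0 ?addr0 ?add0r ?subr0 ?subKr ?expr0 ?expr1 ?mul1r ?mulr1.
apply: bounded_convergence.
  move=> n; apply: unit_interval_valuedM; exact: unit_interval_valued_pow_ncount.
by move=> w; apply: cvgM; exact: cvg_pow_card.
Qed.


Lemma ncount_sum_indic (A : set S) w n :
  (ncount (points_in A w) n)%:R = \sum_(i < n) \1_A (Z i w) :> R.
Proof.
rewrite /ncount natr_sum; apply: eq_bigr => i _.
by rewrite indicE.
Qed.

(** The formula is the derivative at s = 1 of the joint generating function of
    the counts in A and D; the two quadratic error bounds replace the
    differentiation under the expectation. *)
Lemma expected_sum_pow_card (A D : set S) (r : R) :
  measurable A -> measurable D -> A `&` D = set0 ->
  (mu A < +oo)%E -> (mu D < +oo)%E -> 0 <= r <= 1 ->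
  (\sum_(i <oo) \int[P]_w (\1_A (Z i w) * pow_card r (points_in D w))%:E)%E =
  (fine (mu A) * expR (- ((1 - r) * fine (mu D))))%:E.
Proof.
move=> mA mD AD0 muA muD r01.
pose W w := pow_card r (points_in D w).
have W01 : unit_interval_valued W by exact: unit_interval_valued_pow_card.
pose a := fine (mu A); pose c := expR (- ((1 - r) * fine (mu D))).
have a0 : 0 <= a by exact: fine_ge0.
have c0 : 0 <= c by exact: expR_ge0.
have A01 i : unit_interval_valued (fun w => \1_A (Z i w) : R).
  by apply: (unit_interval_valued_comp (mZ i)); exact: unit_interval_valued_indic.
have AW01 i : unit_interval_valued (fun w => \1_A (Z i w) * W w).
  exact: unit_interval_valuedM.
(* S_ n is the expectation of the number N of points of index less than n in A,
   times W. The functions F e n increase to G e, whose expectation is known, and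
   e * N * W exceeds F e n by at most n ^ 2 * e ^ 2. *)
pose S_ n := \sum_(i < n) fine (\int[P]_w (\1_A (Z i w) * W w)%:E)%E.
pose N w n : R := (ncount (points_in A w) n)%:R.
have mN n : measurable_fun setT (N ^~ n).
  under eq_fun do rewrite /N ncount_sum_indic.
  by apply: measurable_sum => i; case: (A01 i).
have S_E n : (\int[P]_w (N w n * W w)%:E)%E = (S_ n)%:E.
  rewrite -sumEFin; under eq_integral do rewrite /N ncount_sum_indic mulr_suml -sumEFin.
  rewrite ge0_integral_sum//.
  - by apply: eq_bigr => i _; rewrite fine_integral_unit.
  - by move=> i; apply/measurable_EFinP; case: (AW01 i).
  - by move=> i w _; rewrite lee_fin; case: (AW01 i) => _ /(_ w)/andP[].
have S_nd : nondecreasing_seq S_.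
  apply/nondecreasing_seqP => n; rewrite /S_ big_ord_recr/= lerDl fine_ge0//.
  by have /andP[] := integral_unit_interval_valued P (AW01 n).
pose F e n w := (1 - (1 - e) ^+ ncount (points_in A w) n) * W w.
pose G e w := (1 - pow_card (1 - e) (points_in A w)) * W w.
have e01' (e : R) : 0 < e <= 1 -> 0 <= 1 - e <= 1.
  by move=> /andP[/ltW e0 e1]; rewrite subr_ge0 e1 gerBl.
have F01 e n : 0 < e <= 1 -> unit_interval_valued (F e n).
  move=> e01; apply: unit_interval_valuedM => //.
  apply: unit_interval_valued_onem.
  by apply: unit_interval_valued_pow_ncount => //; exact: e01'.
have G01 e : 0 < e <= 1 -> unit_interval_valued (G e).
  move=> e01; apply: unit_interval_valuedM => //.
  apply: unit_interval_valued_onem.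
  by apply: unit_interval_valued_pow_card => //; exact: e01'.
have GE e : 0 < e <= 1 ->
    (\int[P]_w (G e w)%:E)%E = (c * (1 - expR (- (e * a))))%:E.
  move=> e01; have ee := e01' _ e01.
  have WE : (\int[P]_w (W w)%:E)%E = c%:E.
    have := joint_generating_function mA mD AD0 muA muD (_ : 0 <= 1 <= 1) r01.
    rewrite lexx ler01 => /(_ isT); rewrite subrr mul0r add0r => <-.
    apply: eq_integral => w _; congr EFin.
    rewrite /pow_card (_ : (fun n => _) = cst 1) ?lim_cst ?mul1r//.
    by apply/funext => n; rewrite expr1n.
  have := joint_generating_function mA mD AD0 muA muD ee r01.
  rewrite subKr opprD expRD -/a -/c => AE.
  have : (\int[P]_w (W w)%:E = \int[P]_w (G e w)%:E +
      \int[P]_w (pow_card (1 - e) (points_in A w) * W w)%:E)%E.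
    have PW01 : unit_interval_valued (fun w => pow_card (1 - e) (points_in A w) * W w).
      by apply: unit_interval_valuedM => //; exact: unit_interval_valued_pow_card.
    rewrite -ge0_integralD//.
    - by apply: eq_integral => w _; rewrite -EFinD /G; congr EFin; ring.
    - by move=> w _; rewrite lee_fin; case: (G01 _ e01) => _ /(_ w)/andP[].
    - by apply/measurable_EFinP; case: (G01 _ e01).
    - by move=> w _; rewrite lee_fin; case: PW01 => _ /(_ w)/andP[].
    - by apply/measurable_EFinP; case: PW01.
  rewrite AE WE -(fine_integral_unit P (G01 _ e01)) -EFinD => -[cE].
  by congr EFin; rewrite mulrBr mulr1 [X in _ = X - _]cE mulrC addrK.
have upper n : S_ n <= a * c.
  apply: (@ler_linear_error _ _ _ (n%:R ^+ 2)) => [|e e01]; first exact: exprn_ge0.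
  have /andP[e0 e1] := e01.
  have : (e%:E * (S_ n)%:E <= \int[P]_w (G e w)%:E + (n%:R ^+ 2 * e ^+ 2)%:E)%E.
    rewrite -S_E -ge0_integralZl ?lee_fin ?(ltW e0)//; last 2 first.
    - by apply/measurable_EFinP; apply: measurable_funM => //; case: W01.
    - by move=> w _; rewrite lee_fin mulr_ge0//; case: W01 => _ /(_ w)/andP[].
    have -> : ((n%:R ^+ 2 * e ^+ 2)%:E = \int[P]_w (n%:R ^+ 2 * e ^+ 2)%:E)%E.
      by rewrite integral_cst//= -[LHS]mule1; congr (_ * _)%E; exact/esym/probability_setT.
    rewrite -ge0_integralD//; last 3 first.
    - by move=> w _; rewrite lee_fin; case: (G01 _ e01) => _ /(_ w)/andP[].
    - by apply/measurable_EFinP; case: (G01 _ e01).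
    - by move=> w _; rewrite lee_fin mulr_ge0// exprn_ge0// ltW.
    apply: ge0_le_integral => //.
    - move=> w _; rewrite -EFinM lee_fin !mulr_ge0 ?(ltW e0)//.
      by case: W01 => _ /(_ w)/andP[].
    - apply: measurable_funeM; apply/measurable_EFinP; apply: measurable_funM => //.
      by case: W01.
    - by apply: emeasurable_funD => //; apply/measurable_EFinP; case: (G01 _ e01).
    - move=> w _; rewrite -EFinM -EFinD lee_fin /G /N.
      set k := ncount _ _; have kn : (k <= n)%N := ncount_le _ _.
      have e01c : 0 <= e <= 1 by rewrite ltW.
      have h1 := onem_expr_ge k e01c.
      have h2 := pow_card_le (points_in A w) (e01' _ e01) n.
      rewrite -/k in h2.
      have [_ /(_ w)/andP[W0 W1]] := W01.
      have h3 : k%:R ^+ 2 <= n%:R ^+ 2 :> R by rewrite ler_sqr ?nnegrE// ler_nat.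
      have h4 : 0 <= k%:R ^+ 2 * e ^+ 2 by rewrite mulr_ge0// exprn_ge0// ltW.
      have h5 : k%:R ^+ 2 * e ^+ 2 <= n%:R ^+ 2 * e ^+ 2.
        by apply: ler_wpM2r => //; rewrite exprn_ge0// ltW.
      have h6 : e * k%:R * W w <=
        (1 - pow_card (1 - e) (points_in A w) + k%:R ^+ 2 * e ^+ 2) * W w.
        by apply: ler_wpM2r => //; lra.
      have h7 : k%:R ^+ 2 * e ^+ 2 * W w <= k%:R ^+ 2 * e ^+ 2 by rewrite ler_piMr.
      by lra.
  rewrite GE// -EFinM -EFinD lee_fin => h.
  have h' := onem_expRN_le (e * a).
  rewrite -(ler_pM2l e0); apply: (le_trans h).
  have : c * (1 - expR (- (e * a))) <= c * (e * a) by exact: ler_wpM2l.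
  nra.
have S_cvg : S_ @ \oo --> limn S_.
  apply: nondecreasing_is_cvgn => //; exists (a * c) => _ [n _ <-]; exact: upper.
have S_lim : limn S_ = a * c.
  apply/eqP; rewrite eq_le; apply/andP; split.
    by apply: limr_le => //; apply: nearW => n; exact: upper.
  apply: (@ler_linear_error _ _ _ (c * a ^+ 2)) => [|e e01].
    by rewrite mulr_ge0// exprn_ge0.
  have /andP[e0 e1] := e01.
  have : c * (1 - expR (- (e * a))) <= e * limn S_.
    rewrite -lee_fin -GE//.
    have FG : (\int[P]_w (F e n w)%:E)%E @[n --> \oo] --> (\int[P]_w (G e w)%:E)%E.
      apply: bounded_convergence => [n|w]; first exact: F01.
      apply: cvgM; last exact: cvg_cst.
      apply: cvgB; first exact: cvg_cst.
      by apply: cvg_pow_card; exact: e01'.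
    rewrite -(cvg_lim _ FG)//; apply: lime_le; first exact: (cvgP _ FG).
    apply: nearW => n; apply: (@le_trans _ _ (e%:E * (S_ n)%:E)%E); last first.
      rewrite -EFinM lee_fin; apply: ler_wpM2l; first exact: ltW.
      exact: nondecreasing_cvgn_le.
    rewrite -S_E -ge0_integralZl ?lee_fin ?(ltW e0)//; last 2 first.
    - by apply/measurable_EFinP; apply: measurable_funM => //; case: W01.
    - by move=> w _; rewrite lee_fin mulr_ge0//; case: W01 => _ /(_ w)/andP[].
    have [mF F01'] := F01 e n e01.
    apply: ge0_le_integral => //.
    - by move=> w _; rewrite lee_fin; case/andP: (F01' w).
    - exact/measurable_EFinP.
    - apply: measurable_funeM; apply/measurable_EFinP; apply: measurable_funM => //.
      by case: W01.
    - move=> w _; rewrite -EFinM lee_fin /F mulrA; apply: ler_wpM2r.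
        by case: W01 => _ /(_ w)/andP[].
      by apply: onem_expr_le; rewrite ltW.
  have h := onem_expRN_ge (mulr_ge0 (ltW e0) a0).
  have : c * (e * a - (e * a) ^+ 2) <= c * (1 - expR (- (e * a))) by exact: ler_wpM2l.
  move=> h1 h2; rewrite -(ler_pM2l e0).
  have := le_trans h1 h2.
  nra.
apply: cvg_lim => //; rewrite -/a -/c -S_lim.
rewrite (_ : (fun n => _) = EFin \o S_); first by apply: cvg_EFin => //; exact: nearW.
apply/funext => n /=; rewrite big_mkord -sumEFin; apply: eq_bigr => i _.
by rewrite fine_integral_unit.
Qed.

End campbell.

(** * The Mecke formula for powers of the number of points seen from a point *)

Section mecke.
Context d (Omega : measurableType d) (R : realType) (P : probability Omega R).
Context dS (S : measurableType dS).
Variable mu : {sigma_finite_measure set S -> \bar R}.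
Variable Z : nat -> Omega -> S.
Hypothesis mZ : forall i, measurable_fun setT (Z i).
Variable r : R.
Hypothesis r01 : 0 <= r <= 1.

Let campbell (A D : set S) :=
  (\sum_(i <oo) \int[P]_w (\1_A (Z i w) * pow_card r (points_in Z D w))%:E)%E =
  (fine (mu A) * expR (- ((1 - r) * fine (mu D))))%:E.

Hypothesis campbell_formula : forall A D : set S,
  measurable A -> measurable D -> A `&` D = set0 ->
  (mu A < +oo)%E -> (mu D < +oo)%E -> campbell A D.

Definition seen_from (U : set (S * S)) (i : nat) (w : Omega) : set nat :=
  points_in Z (xsection U (Z i w)) w.

Definition point_sum (C : set S) (U : set (S * S)) : \bar R :=
  (\sum_(i <oo) \int[P]_w (\1_C (Z i w) * pow_card r (seen_from U i w))%:E)%E.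

Definition void_weight (U : set (S * S)) (z : S) : R :=
  expR (- ((1 - r) * fine (mu (xsection U z)))).

Definition mean_sum (C : set S) (U : set (S * S)) : \bar R :=
  (\int[mu]_z (\1_C z * void_weight U z)%:E)%E.

Lemma unit_interval_valued_seen_from U i : measurable U ->
  unit_interval_valued (fun w => pow_card r (seen_from U i w)).
Proof.
move=> mU; apply: (@unit_interval_valued_limit _ _ _
  (fun n w => r ^+ ncount (seen_from U i w) n)).
  move=> n; have /andP[r0 r1] := r01; split; last first.
    by move=> w; rewrite exprn_ge0//= exprn_ile1.
  under eq_fun do rewrite -prod_pow_ncount.
  apply: measurable_prod => j _.
  rewrite (_ : (fun w => _) = fun w =>
      r * \1_U (Z i w, Z j w) + (1 - \1_U (Z i w, Z j w))); last first.
    apply/funext => w; rewrite indicE.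
    have -> : (val j \in seen_from U i w) = ((Z i w, Z j w) \in U).
      by rewrite -mem_xsection.
    by case: (_ \in U); rewrite /= ?mulr1 ?mulr0 ?subrr ?subr0 ?addr0 ?add0r ?expr1 ?expr0.
  have m1 : measurable_fun setT (fun w => \1_U (Z i w, Z j w) : R).
    apply: (@measurableT_comp _ _ _ _ _ _ (\1_U : S * S -> R)).
      exact: measurable_indic.
    exact: measurable_fun_pair.
  by apply: measurable_funD; [exact: measurable_funM|exact: measurable_funB].
by move=> w; exact: cvg_pow_card.
Qed.

Lemma unit_interval_valued_point_term C U i : measurable C -> measurable U ->
  unit_interval_valued (fun w => \1_C (Z i w) * pow_card r (seen_from U i w)).
Proof.
move=> mC mU; apply: unit_interval_valuedM.
  by apply: (unit_interval_valued_comp (mZ i)); exact: unit_interval_valued_indic.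
exact: unit_interval_valued_seen_from.
Qed.

Lemma measurable_void_weight U : measurable U -> measurable_fun setT (void_weight U).
Proof.
move=> mU; apply: measurableT_comp; first exact: measurable_expR.
apply: measurableT_comp => //; apply: measurable_funM => //.
by apply: measurableT_comp => //; exact: measurable_fun_xsection.
Qed.

Lemma void_weight_ge0 U z : 0 <= void_weight U z.
Proof. exact: expR_ge0. Qed.

Lemma void_weight_le1 U z : void_weight U z <= 1.
Proof.
rewrite -[leRHS]expR0 ler_expR oppr_le0 mulr_ge0 ?fine_ge0// subr_ge0.
by case/andP: r01.
Qed.

Lemma indic_split (C A : set S) z : \1_C z = \1_(C `&` A) z + \1_(C `\` A) z :> R.
Proof.
rewrite !indicE in_setI in_setD.
by case: (z \in C); case: (z \in A); rewrite /= ?addr0 ?add0r.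
Qed.

Lemma point_sum_split C A U : measurable C -> measurable A -> measurable U ->
  point_sum C U = (point_sum (C `&` A) U + point_sum (C `\` A) U)%E.
Proof.
move=> mC mA mU; rewrite /point_sum.
have CA : measurable (C `&` A) by exact: measurableI.
have CDA : measurable (C `\` A) by exact: measurableD.
have ge0 B i w : measurable B ->
    (0 <= (\1_B (Z i w) * pow_card r (seen_from U i w))%:E)%E.
  move=> mB; rewrite lee_fin.
  by case: (unit_interval_valued_point_term i mB mU) => _ /(_ w)/andP[].
rewrite -nneseriesD; last 2 first.
- by move=> i _ _; apply: integral_ge0 => w _; exact: ge0.
- by move=> i _ _; apply: integral_ge0 => w _; exact: ge0.
apply: eq_eseriesr => i _; rewrite -ge0_integralD//.
- by apply: eq_integral => w _; rewrite -EFinD -mulrDl -indic_split.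
- by move=> w _; exact: ge0.
- by apply/measurable_EFinP; case: (unit_interval_valued_point_term i CA mU).
- by move=> w _; exact: ge0.
- by apply/measurable_EFinP; case: (unit_interval_valued_point_term i CDA mU).
Qed.

Lemma mean_sum_split C A U : measurable C -> measurable A -> measurable U ->
  mean_sum C U = (mean_sum (C `&` A) U + mean_sum (C `\` A) U)%E.
Proof.
move=> mC mA mU; rewrite /mean_sum.
have CA : measurable (C `&` A) by exact: measurableI.
have CDA : measurable (C `\` A) by exact: measurableD.
have mt B : measurable B -> measurable_fun setT (fun z => (\1_B z * void_weight U z)%:E).
  move=> mB; apply/measurable_EFinP; apply: measurable_funM.
    exact: measurable_indic.
  exact: measurable_void_weight.
rewrite -ge0_integralD//.
- by apply: eq_integral => z _; rewrite -EFinD -mulrDl -indic_split.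
- by move=> z _; rewrite lee_fin mulr_ge0// void_weight_ge0.
- exact: mt.
- by move=> z _; rewrite lee_fin mulr_ge0// void_weight_ge0.
- exact: mt.
Qed.

Lemma eq_point_sum (C : set S) U V : (forall z, C z -> xsection U z = xsection V z) ->
  point_sum C U = point_sum C V.
Proof.
move=> UV; apply: eq_eseriesr => i _; apply: eq_integral => w _; congr EFin.
rewrite indicE; case: (boolP (_ \in C)) => [/set_mem Cz|_]; rewrite ?mul0r// !mul1r.
by rewrite /seen_from UV.
Qed.

Lemma eq_mean_sum (C : set S) U V : (forall z, C z -> xsection U z = xsection V z) ->
  mean_sum C U = mean_sum C V.
Proof.
move=> UV; apply: eq_integral => z _; congr EFin.
rewrite indicE; case: (boolP (_ \in C)) => [/set_mem Cz|_]; rewrite ?mul0r// !mul1r.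
by rewrite /void_weight UV.
Qed.


Lemma mecke_strip (C D : set S) : measurable C -> measurable D -> C `&` D = set0 ->
  (mu C < +oo)%E -> (mu D < +oo)%E ->
  point_sum C (setT `*` D) = mean_sum C (setT `*` D).
Proof.
move=> mC mD CD muC muD.
have xD z : xsection (setT `*` D) z = D by rewrite in_xsectionX// in_setT.
rewrite /point_sum; under eq_eseriesr do rewrite /seen_from.
transitivity (\sum_(i <oo) \int[P]_w (\1_C (Z i w) * pow_card r (points_in Z D w))%:E)%E.
  by apply: eq_eseriesr => i _; apply: eq_integral => w _; rewrite xD.
rewrite campbell_formula// /mean_sum /void_weight.
under [RHS]eq_integral do rewrite xD EFinM.
rewrite ge0_integralZr//; last first.
  by apply/measurable_EFinP; exact: measurable_indic.
by rewrite integral_indic// setIT EFinM fineK// ge0_fin_numE.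
Qed.

Section rectangles.
Variables A B : nat -> set S.
Hypotheses (mA : forall k, measurable (A k)) (mB : forall k, measurable (B k)).
Hypothesis AB0 : forall k, A k `&` B k = set0.
Hypothesis muB : forall k, (mu (B k) < +oo)%E.

Definition rectangle_union n : set (S * S) := \bigcup_(k in `I_n) (A k `*` B k).

Lemma measurable_rectangle_union n : measurable (rectangle_union n).
Proof. by apply: bigcup_measurable => k _; exact: measurableX. Qed.

Lemma rectangle_unionS n :
  rectangle_union n.+1 = rectangle_union n `|` (A n `*` B n).
Proof. by rewrite /rectangle_union IIS bigcup_setU bigcup_set1. Qed.

(** On the cell C, which does not meet the part D already seen from it, the
    set seen from z is D together with the B k such that z is in A k. Cutting C
    along the sets A k one by one makes the set seen constant on each piece. *)
Lemma mecke_rectangles n (C D : set S) : measurable C -> measurable D ->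
  C `&` D = set0 -> (mu C < +oo)%E -> (mu D < +oo)%E ->
  point_sum C ((setT `*` D) `|` rectangle_union n) =
  mean_sum C ((setT `*` D) `|` rectangle_union n).
Proof.
elim: n C D => [|n IH] C D mC mD CD muC muD.
  by rewrite /rectangle_union II0 bigcup_set0 setU0; exact: mecke_strip.
pose U := (setT `*` D) `|` rectangle_union n.+1.
have mT : measurable (setT `*` D : set (S * S)) by exact: measurableX.
have mU : measurable U.
  by apply: measurableU => //; exact: measurable_rectangle_union.
have mCA : measurable (C `&` A n) by exact: measurableI.
have mCDA : measurable (C `\` A n) by exact: measurableD.
rewrite -/U (point_sum_split mC (mA n) mU) (mean_sum_split mC (mA n) mU).
have xin z : (C `&` A n) z ->
    xsection U z = xsection ((setT `*` (D `|` B n)) `|` rectangle_union n) z.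
  move=> [_ Az]; apply/seteqP; split => y /xsectionP h; apply/xsectionP.
    move: h; rewrite /U rectangle_unionS => -[[_ Dy]|[h|[_ By]]].
    - by left; split => //; left.
    - by right.
    - by left; split => //; right.
  rewrite /U rectangle_unionS; case: h => [[_ [Dy|By]]|h].
  - by left.
  - by right; right.
  - by right; left.
have xout z : (C `\` A n) z ->
    xsection U z = xsection ((setT `*` D) `|` rectangle_union n) z.
  move=> [_ Az]; apply/seteqP; split => y /xsectionP h; apply/xsectionP.
    by move: h; rewrite /U rectangle_unionS => -[h|[h|[]//]]; [left|right].
  by rewrite /U rectangle_unionS; case: h => [h|h]; [left|right; left].
rewrite (eq_point_sum xin) (eq_point_sum xout) (eq_mean_sum xin) (eq_mean_sum xout).
congr (_ + _)%E.
- apply: IH => //.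
  + exact: measurableU.
  + rewrite setIUr -setIA (setIC (A n)) setIA CD set0I set0U.
    by rewrite -setIA AB0 setI0.
  + by apply: le_lt_trans muC; apply: le_measure; rewrite ?inE//; exact: subIsetl.
  + apply: (@le_lt_trans _ _ (mu D + mu (B n))%E); first exact: measureU2.
    exact: lte_add_pinfty.
- apply: IH => //.
  + by rewrite setDE -setIA (setIC (~` _)) setIA CD set0I.
  + by apply: le_lt_trans muC; apply: le_measure; rewrite ?inE//; exact: subDsetl.
Qed.

End rectangles.

End mecke.

Section mecke_limit.
Context d (Omega : measurableType d) (R : realType) (P : probability Omega R).
Context dS (S : measurableType dS).
Variable mu : {sigma_finite_measure set S -> \bar R}.
Variable Z : nat -> Omega -> S.
Hypothesis mZ : forall i, measurable_fun setT (Z i).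
Variable r : R.
Hypothesis r01 : 0 <= r <= 1.

Hypothesis campbell_formula : forall A D : set S,
  measurable A -> measurable D -> A `&` D = set0 ->
  (mu A < +oo)%E -> (mu D < +oo)%E ->
  (\sum_(i <oo) \int[P]_w (\1_A (Z i w) * pow_card r (points_in Z D w))%:E)%E =
  (fine (mu A) * expR (- ((1 - r) * fine (mu D))))%:E.

Lemma cvg_pow_card_bigcup (E : nat -> set nat) :
  {homo E : m n / (m <= n)%N >-> m `<=` n} ->
  pow_card r (E n) @[n --> \oo] --> pow_card r (\bigcup_n E n).
Proof.
move=> ndE; have /andP[r0 r1] := r01.
have cvgN N : r ^+ ncount (E n) N @[n --> \oo] --> r ^+ ncount (\bigcup_n E n) N.
  rewrite -prod_pow_ncount.
  rewrite (_ : (fun n => _) = fun n => \prod_(j < N) r ^+ (val j \in E n)); last first.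
    by apply/funext => n; rewrite prod_pow_ncount.
  apply: cvg_big => [|j _]; first exact: mul_continuous.
  apply: cvg_near_cst.
  have [[m _ Em]|nE] := pselect ((\bigcup_n E n) (val j)).
    exists m => // n /= mn.
    by rewrite !mem_set//; [exists m|exact: (ndE _ _ mn)].
  near=> n; rewrite !memNset// => En; apply: nE; exists n => //.
apply: (@nonincreasing_double_limit R (fun N n => r ^+ ncount (E n) N)
  _ (fun N => r ^+ ncount (\bigcup_n E n) N)).
- move=> N m n mn; apply: ler_wiXn2l => //; exact/subset_ncount/ndE.
- by move=> n; exact: nonincreasing_pow_ncount.
- exact: cvgN.
- by move=> n; exact: cvg_pow_card.
- exact: cvg_pow_card.
Unshelve. all: by end_near. Qed.

Lemma pow_card_set0 (s : R) : pow_card s set0 = 1.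
Proof.
rewrite /pow_card (_ : (fun n => _) = cst 1) ?lim_cst//.
by apply/funext => n; rewrite /ncount big1 ?expr0// => j _; rewrite in_set0.
Qed.

Lemma expected_points (C : set S) : measurable C -> (mu C < +oo)%E ->
  (\sum_(i <oo) \int[P]_w (\1_C (Z i w))%:E)%E = mu C.
Proof.
move=> mC muC.
have := campbell_formula mC measurable0 (setI0 C) muC.
rewrite measure0 => /(_ (ltry 0)); rewrite mulr0 oppr0 expR0 mulr1 fineK.
  move=> <-; apply: eq_eseriesr => i _; apply: eq_integral => w _.
  by rewrite (_ : points_in _ _ _ = set0) ?pow_card_set0 ?mulr1.
by rewrite ge0_fin_numE.
Qed.

Variables A B : nat -> set S.
Hypotheses (mA : forall k, measurable (A k)) (mB : forall k, measurable (B k)).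
Hypothesis AB0 : forall k, A k `&` B k = set0.
Hypothesis muB : forall k, (mu (B k) < +oo)%E.

Let U := \bigcup_k (A k `*` B k).
Hypothesis muU : forall z, (mu (xsection U z) < +oo)%E.

Let mU : measurable U.
Proof. by apply: bigcup_measurable => k _; exact: measurableX. Qed.

Let mUn n : measurable (rectangle_union A B n).
Proof. exact: measurable_rectangle_union. Qed.

Let ndU : {homo rectangle_union A B : m n / (m <= n)%N >-> m `<=` n}.
Proof.
move=> m n mn; apply: bigcup_subset => k /= km; exact: leq_trans mn.
Qed.

Let bigcupU : \bigcup_n rectangle_union A B n = U.
Proof.
apply/seteqP; split=> [z [n _ [k _ h]]|z [k _ h]]; first by exists k.
by exists k.+1 => //; exists k => /=.
Qed.

Let xsection_nd z : {homo (fun n => xsection (rectangle_union A B n) z) :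
  m n / (m <= n)%N >-> m `<=` n}.
Proof. by move=> m n mn; exact/le_xsection/ndU. Qed.

Let muUn n z : (mu (xsection (rectangle_union A B n) z) < +oo)%E.
Proof.
apply: le_lt_trans (muU z); apply: le_measure; rewrite ?inE; last first.
- by apply: le_xsection; rewrite -bigcupU; exact: bigcup_sup.
- exact: measurable_xsection.
- exact: measurable_xsection.
Qed.

Let cvg_point_sum (C : set S) : measurable C -> (mu C < +oo)%E ->
  point_sum P Z r C (rectangle_union A B n) @[n --> \oo] --> point_sum P Z r C U.
Proof.
move=> mC muC.
have ge0 V i : measurable V ->
    (0 <= \int[P]_w (\1_C (Z i w) * pow_card r (seen_from Z V i w))%:E)%E.
  move=> mV; apply: integral_ge0 => w _; rewrite lee_fin.
  by case: (unit_interval_valued_point_term mZ r01 i mC mV) => _ /(_ w)/andP[].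
have sumE V : measurable V -> point_sum P Z r C V = (\int[@counting nat R]_i
    \int[P]_w (\1_C (Z i w) * pow_card r (seen_from Z V i w))%:E)%E.
  by move=> mV; rewrite ge0_integral_count// => i; exact: ge0.
rewrite (sumE _ mU) (_ : (fun n => _) = fun n => (\int[@counting nat R]_i
    \int[P]_w (\1_C (Z i w) * pow_card r (seen_from Z (rectangle_union A B n) i w))%:E)%E);
  last by apply/funext => n; exact: sumE.
have [|||||_ _] := @dominated_convergence _ _ _ (@counting nat R) setT measurableT
  (fun n i => \int[P]_w (\1_C (Z i w) * pow_card r (seen_from Z (rectangle_union A B n) i w))%:E)%E
  (fun i => \int[P]_w (\1_C (Z i w) * pow_card r (seen_from Z U i w))%:E)%E
  (fun i => \int[P]_w (\1_C (Z i w))%:E)%E => //.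
- apply: aeW => i _; apply: bounded_convergence => [n|w].
    exact: (unit_interval_valued_point_term mZ r01 i mC (mUn n)).
  apply: cvgM; first exact: cvg_cst.
  rewrite /seen_from -bigcupU xsection_bigcup.
  rewrite (_ : points_in _ _ _ = \bigcup_n points_in Z (xsection (rectangle_union A B n) (Z i w)) w)//.
  by apply: cvg_pow_card_bigcup => m n mn j; exact: xsection_nd.
- apply/integrableP; split => //.
  rewrite (eq_integral (fun i => \int[P]_w (\1_C (Z i w))%:E)%E); last first.
    by move=> i _; rewrite gee0_abs//; apply: integral_ge0 => w _; rewrite lee_fin.
  rewrite ge0_integral_count; last by move=> i; apply: integral_ge0 => w _; rewrite lee_fin.
  by rewrite expected_points.
- apply: aeW => i n _; rewrite gee0_abs; last exact: ge0.
  have [mt t01] := unit_interval_valued_point_term mZ r01 i mC (mUn n).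
  apply: ge0_le_integral => //.
  + by move=> w _; rewrite lee_fin; case/andP: (t01 w).
  + exact/measurable_EFinP.
  + by apply/measurable_EFinP; apply: measurableT_comp => //; exact: measurable_indic.
  + move=> w _; rewrite lee_fin ler_piMr//.
    by case: (unit_interval_valued_seen_from mZ r01 i (mUn n)) => _ /(_ w)/andP[].
Qed.

Let cvg_void_weight z :
  void_weight mu r (rectangle_union A B n) z @[n --> \oo] --> void_weight mu r U z.
Proof.
apply: continuous_cvg; first exact: continuous_expR.
apply: cvgN; apply: cvgM; first exact: cvg_cst.
apply: fine_cvg; rewrite fineK ?ge0_fin_numE//.
rewrite -bigcupU xsection_bigcup; apply: nondecreasing_cvg_mu.
- by move=> n; exact: measurable_xsection.
- by apply: bigcup_measurable => n _; exact: measurable_xsection.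
- by move=> m n mn; apply/subsetPset; exact: xsection_nd.
Qed.

Let cvg_mean_sum (C : set S) : measurable C -> (mu C < +oo)%E ->
  mean_sum mu r C (rectangle_union A B n) @[n --> \oo] --> mean_sum mu r C U.
Proof.
move=> mC muC; rewrite /mean_sum.
have mt V : measurable V -> measurable_fun setT (fun z => (\1_C z * void_weight mu r V z)%:E).
  move=> mV; apply/measurable_EFinP; apply: measurable_funM.
    exact: measurable_indic.
  exact: measurable_void_weight.
have [|||||_ _] := @dominated_convergence _ _ _ mu setT measurableT
  (fun n z => (\1_C z * void_weight mu r (rectangle_union A B n) z)%:E)
  (fun z => (\1_C z * void_weight mu r U z)%:E) (fun z => (\1_C z)%:E) => //.
- by move=> n; exact: mt.
- exact: mt.
- apply: aeW => z _; apply: cvg_EFin; first exact: nearW.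
  by apply: cvgM; [exact: cvg_cst|exact: cvg_void_weight].
- apply/integrableP; split; first by apply/measurable_EFinP; exact: measurable_indic.
  rewrite (eq_integral (fun z => (\1_C z)%:E)); last first.
    by move=> z _; rewrite gee0_abs// lee_fin.
  by rewrite integral_indic// setIT.
- apply: aeW => z n _; rewrite gee0_abs; last by rewrite lee_fin mulr_ge0// void_weight_ge0.
  by rewrite lee_fin ler_piMr// void_weight_le1.
Qed.

Let mecke_finite (C : set S) : measurable C -> (mu C < +oo)%E ->
  point_sum P Z r C U = mean_sum mu r C U.
Proof.
move=> mC muC; apply: (cvg_unique _ (cvg_point_sum mC muC)) => //.
rewrite (_ : (fun n => _) = fun n => mean_sum mu r C (rectangle_union A B n)).
  exact: cvg_mean_sum.
apply/funext => n.
have := mecke_rectangles mZ r01 campbell_formula mA mB AB0 muB n mC measurable0 (setI0 C) muC.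
by rewrite measure0 setX0 set0U => /(_ (ltry 0)).
Qed.


Let cvg_indic (C : set S) (F : nat -> set S) z :
  \bigcup_n F n = setT -> nondecreasing_seq F ->
  \1_(C `&` F n) z @[n --> \oo] --> (\1_C z : R).
Proof.
move=> FT ndF; have : (\bigcup_n F n) z by rewrite FT.
move=> [m _ Fz]; apply: cvg_near_cst; exists m => // n /= mn.
have Fnz : F n z by have /subsetPset := ndF _ _ mn; apply.
by rewrite indicI/= [\1_(F n) z]indicE mem_set ?mulr1.
Qed.

Let le_indic (C : set S) (F : nat -> set S) z : nondecreasing_seq F ->
  nondecreasing_seq (fun n => \1_(C `&` F n) z : R).
Proof.
move=> ndF m n mn; rewrite !indicI/= ler_wpM2l//.
rewrite !indicE; case: (boolP (z \in F m)) => // /set_mem Fz.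
by rewrite mem_set//; have /subsetPset := ndF _ _ mn; apply.
Qed.

(** The set U is the increasing union of finite unions of rectangles, along
    which both sides converge by domination when C has finite measure: the terms
    on the left are at most P (Z i in C), and the sum of these is mu C. A general
    C is exhausted by sets of finite measure. *)
Theorem mecke_pow_card (C : set S) : measurable C ->
  point_sum P Z r C U = mean_sum mu r C U.
Proof.
move=> mC; have /sigma_finiteP[F [TF ndF Foo]] := sigma_finiteT mu.
have mF n : measurable (F n) by case: (Foo n).
have mCF n : measurable (C `&` F n) by exact: measurableI.
have muCF n : (mu (C `&` F n) < +oo)%E.
  by case: (Foo n) => _; apply: le_lt_trans; apply: le_measure; rewrite ?inE.
have pt01 D i : measurable D -> unit_interval_valued
    (fun w => \1_D (Z i w) * pow_card r (seen_from Z U i w)).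
  by move=> mD; exact: unit_interval_valued_point_term.
have ge0 D i : measurable D ->
    (0 <= \int[P]_w (\1_D (Z i w) * pow_card r (seen_from Z U i w))%:E)%E.
  move=> mD; apply: integral_ge0 => w _; rewrite lee_fin.
  by case: (pt01 D i mD) => _ /(_ w)/andP[].
have sumE D : measurable D -> point_sum P Z r D U = (\int[@counting nat R]_i
    \int[P]_w (\1_D (Z i w) * pow_card r (seen_from Z U i w))%:E)%E.
  by move=> mD; rewrite ge0_integral_count// => i; exact: ge0.
have seen0 i w : 0 <= pow_card r (seen_from Z U i w).
  by case: (unit_interval_valued_seen_from mZ r01 i mU) => _ /(_ w)/andP[].
have lhs : point_sum P Z r (C `&` F n) U @[n --> \oo] --> point_sum P Z r C U.
  rewrite (sumE _ mC) (_ : (fun n => _) = fun n => (\int[@counting nat R]_i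
    \int[P]_w (\1_(C `&` F n) (Z i w) * pow_card r (seen_from Z U i w))%:E)%E);
    last by apply/funext => n; exact: sumE.
  have inner i : (\int[P]_w (\1_(C `&` F n) (Z i w) * pow_card r (seen_from Z U i w))%:E)%E
      @[n --> \oo] --> (\int[P]_w (\1_C (Z i w) * pow_card r (seen_from Z U i w))%:E)%E.
    apply: bounded_convergence => [n|w]; first exact: pt01.
    by apply: cvgM; [exact: cvg_indic|exact: cvg_cst].
  rewrite (_ : (\int[_]_i _)%E = (\int[@counting nat R]_i limn (fun n =>
      \int[P]_w (\1_(C `&` F n) (Z i w) * pow_card r (seen_from Z U i w))%:E))%E).
    apply: cvg_monotone_convergence => //.
    - by move=> n i _; exact: ge0.
    - move=> i _ m n mn; apply: ge0_le_integral => //.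
      + by move=> w _; rewrite lee_fin; case: (pt01 _ i (mCF m)) => _ /(_ w)/andP[].
      + by apply/measurable_EFinP; case: (pt01 _ i (mCF m)).
      + by apply/measurable_EFinP; case: (pt01 _ i (mCF n)).
      + by move=> w _; rewrite lee_fin ler_wpM2r//; exact: le_indic.
  by apply: eq_integral => i _; apply/esym/cvg_lim => //; exact: inner.
apply: (cvg_unique _ lhs) => //.
rewrite (_ : (fun n => _) = fun n => mean_sum mu r (C `&` F n) U); last first.
  by apply/funext => n; exact: mecke_finite.
rewrite /mean_sum (_ : (\int[mu]_z (\1_C z * _)%:E)%E = (\int[mu]_z
    limn (fun n => (\1_(C `&` F n) z * void_weight mu r U z)%:E))%E).
  apply: cvg_monotone_convergence => //.
  - move=> n; apply/measurable_EFinP; apply: measurable_funM.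
      exact: measurable_indic.
    exact: measurable_void_weight.
  - by move=> n z _; rewrite lee_fin mulr_ge0// void_weight_ge0.
  - move=> z _ m n mn; rewrite lee_fin ler_wpM2r ?void_weight_ge0//.
    exact: le_indic.
apply: eq_integral => z _; apply/esym/cvg_lim => //.
apply: cvg_EFin; first exact: nearW.
by apply: cvgM; [exact: cvg_indic|exact: cvg_cst].
Qed.

End mecke_limit.

(** * Planar Lebesgue measure *)

Section lebesgue_invariance.
Context (R : realType).
Local Notation L := (@lebesgue_measure R).
Local Open Scope ereal_scope.

Lemma lebesgue_translation (a : R) (A : set R) : measurable A ->
  pushforward L (fun x : measurableTypeR R => (x + a)%R : measurableTypeR R) A = L A.
Proof.
move=> mA; apply/esym/lebesgue_measure_unique => //= [|_ _ [[b c] _ <-]].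
  exact: measurable_funD.
rewrite /pushforward.
rewrite (_ : _ @^-1` _ = `](b - a)%R, (c - a)%R]%classic); last first.
  by apply/seteqP; split => x /=; rewrite !in_itv/= ltrBlDr lerBrDr.
rewrite !lebesgue_measure_itv/= !lte_fin ltrD2r.
by case: ifP => // _; rewrite -!EFinD; congr _%:E; ring.
Qed.

Lemma ge0_integral_translation (a : R) (f : R -> \bar R) :
  measurable_fun setT f -> (forall x, 0 <= f x) ->
  \int[L]_x f (x + a)%R = \int[L]_x f x.
Proof.
move=> mf f0.
have mt : measurable_fun setT (fun x : measurableTypeR R => (x + a)%R : measurableTypeR R).
  exact: measurable_funD.
have := ge0_integral_pushforward mt L measurableT mf (fun y _ => f0 y).
rewrite preimage_setT => <-.
by apply: eq_measure_integral => //= A mA _; exact: lebesgue_translation.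
Qed.

Lemma area_tonelli1 (f : plane R -> \bar R) :
  measurable_fun setT f -> (forall p, 0 <= f p) ->
  \int[@area R]_p f p = \int[L]_x \int[L]_y f (x, y).
Proof. exact: (@fubini_tonelli1 _ _ _ _ R L L f). Qed.

Lemma area_tonelli2 (f : plane R -> \bar R) :
  measurable_fun setT f -> (forall p, 0 <= f p) ->
  \int[@area R]_p f p = \int[L]_y \int[L]_x f (x, y).
Proof. exact: (@fubini_tonelli2 _ _ _ _ R L L f). Qed.

Lemma measurable_shear1 (a : R) :
  measurable_fun setT (fun p : plane R => ((p.1 + a * p.2)%R, p.2) : plane R).
Proof.
apply: measurable_fun_pair => //=.
by apply: measurable_funD => //; exact: measurable_funM.
Qed.

Lemma measurable_shear2 (a : R) :
  measurable_fun setT (fun p : plane R => (p.1, (p.2 + a * p.1)%R) : plane R).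
Proof.
apply: measurable_fun_pair => //=.
by apply: measurable_funD => //; exact: measurable_funM.
Qed.

Lemma ge0_integral_shear1 (a : R) (f : plane R -> \bar R) :
  measurable_fun setT f -> (forall x, 0 <= f x) ->
  \int[@area R]_p f ((p.1 + a * p.2)%R, p.2) = \int[@area R]_p f p.
Proof.
move=> mf f0; rewrite (area_tonelli2 mf f0).
rewrite (area_tonelli2 (measurableT_comp mf (measurable_shear1 a)) (fun p => f0 _)).
apply: eq_integral => y _ /=.
apply: (ge0_integral_translation (a * y) (f := fun x => f (x, y))) => //.
exact: measurableT_comp.
Qed.

Lemma ge0_integral_shear2 (a : R) (f : plane R -> \bar R) :
  measurable_fun setT f -> (forall x, 0 <= f x) ->
  \int[@area R]_p f (p.1, (p.2 + a * p.1)%R) = \int[@area R]_p f p.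
Proof.
move=> mf f0; rewrite (area_tonelli1 mf f0).
rewrite (area_tonelli1 (measurableT_comp mf (measurable_shear2 a)) (fun p => f0 _)).
apply: eq_integral => x _ /=.
apply: (ge0_integral_translation (a * x) (f := fun y => f (x, y))) => //.
exact: measurableT_comp.
Qed.

Definition rotate (c s : R) (p : plane R) : plane R :=
  ((p.1 * c + p.2 * s)%R, (p.2 * c - p.1 * s)%R).

Lemma measurable_rotate c s : measurable_fun setT (rotate c s).
Proof.
apply: measurable_fun_pair; [apply: measurable_funD|apply: measurable_funB];
  by apply: measurable_funM.
Qed.

(** A rotation is a product of three shears, each of which preserves the area
    because it translates every line parallel to an axis. The slope a of the
    outer shears is undefined for the half turn, which is the square of a quarter
    turn. *)
Lemma ge0_integral_rotate (c s : R) (f : plane R -> \bar R) :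
  (c ^+ 2 + s ^+ 2 = 1)%R -> measurable_fun setT f -> (forall x, 0 <= f x) ->
  \int[@area R]_p f (rotate c s p) = \int[@area R]_p f p.
Proof.
have base (c' s' : R) (g : plane R -> \bar R) : (c' != -1)%R ->
    (c' ^+ 2 + s' ^+ 2 = 1)%R -> measurable_fun setT g -> (forall x, 0 <= g x) ->
    \int[@area R]_p g (rotate c' s' p) = \int[@area R]_p g p.
  move=> cN1 cs mg g0; have c10 : (1 + c' != 0)%R by rewrite addrC addr_eq0.
  pose a := (s' / (1 + c'))%R.
  have a_s : (a * s' = 1 - c')%R.
    rewrite /a mulrAC -expr2 (_ : s' ^+ 2 = (1 - c') * (1 + c'))%R ?mulfK//.
    have -> : (s' ^+ 2 = 1 - c' ^+ 2)%R by rewrite -cs addrC addKr.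
    by ring.
  have ac : (a * (1 + c') = s')%R by rewrite /a mulfVK.
  pose h1 p : \bar R := g ((p.1 + a * p.2)%R, p.2).
  pose h2 p : \bar R := h1 (p.1, (p.2 + (- s') * p.1)%R).
  have m1 : measurable_fun setT h1 by exact: (measurableT_comp mg (measurable_shear1 a)).
  have m2 : measurable_fun setT h2 by exact: (measurableT_comp m1 (measurable_shear2 (- s'))).
  have h10 p : 0 <= h1 p by exact: g0.
  have h20 p : 0 <= h2 p by exact: h10.
  rewrite -(ge0_integral_shear1 a mg g0) -(ge0_integral_shear2 (- s') m1 h10).
  rewrite -(ge0_integral_shear1 a m2 h20).
  apply: eq_integral => p _; rewrite /h2 /h1 /rotate/=.
  have E : (a * (2 - a * s') = s')%R.
    by rewrite a_s -[RHS]ac; ring.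
  have -> : (c' = 1 - a * s')%R by rewrite a_s subKr.
  move: E; move: (a : R) => b E; congr (g (_, _)); last by ring.
  by rewrite -[X in (_ + _ * X)%R = _]E; ring.
have [c1|cN1] := eqVneq c (-1)%R; last exact: base.
rewrite c1 {c c1}.
rewrite sqrrN expr1n -[X in _ = X -> _]addr0 => /addrI/eqP.
rewrite sqrf_eq0 => /eqP -> mf f0.
have q : (0 ^+ 2 + 1 ^+ 2 = 1 :> R)%R by rewrite expr0n expr1n add0r.
have q0 : (0 != -1 :> R)%R by rewrite eq_sym oppr_eq0 oner_eq0.
rewrite -(base _ _ _ q0 q mf f0).
rewrite -(base _ _ (fun p => f (rotate 0 1 p)) q0 q)//; last first.
  by apply: measurableT_comp => //; exact: measurable_rotate.
apply: eq_integral => p _; rewrite /rotate/=; congr (f (_, _)); ring.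
Qed.

End lebesgue_invariance.

Section disc.
Context (R : realType).
Local Notation L := (@lebesgue_measure R).

Definition disc_at (a b rho : R) : set (plane R) :=
  [set p | (p.1 + a) ^+ 2 + (p.2 + b) ^+ 2 < rho].

Let half_disc_derivative (h t : R) :
  is_derive t 1 (fun t => h ^+ 2 * (t + sin t * cos t)) (2 * h ^+ 2 * cos t ^+ 2).
Proof.
apply: is_derive_eq; rewrite /GRing.scale/= mulrN -!expr2.
have -> : sin t ^+ 2 = 1 - cos t ^+ 2 by rewrite cos2sin2 subKr.
by ring.
Qed.

(** Substitute x = h sin t. *)
Lemma integral_half_chord (h : R) : 0 < h ->
  (\int[L]_(x in `[(- h)%R, h]) (2 * Num.sqrt (h ^+ 2 - x ^+ 2))%:E = (pi * h ^+ 2)%:E)%E.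
Proof.
move=> h0.
pose F t : R := h * sin t.
pose G x : R := 2 * Num.sqrt (h ^+ 2 - x ^+ 2).
have F1 : h = F (pi / 2) by rewrite /F sin_pihalf mulr1.
have F2 : - h = F (- (pi / 2)) by rewrite /F sinN sin_pihalf mulrN mulr1.
have dF (t : R) : is_derive t 1 F (h * cos t).
  by apply: is_derive_eq; rewrite /GRing.scale/= ?mulr0 ?mulr1 ?addr0 ?add0r.
have F'E : F^`()%classic = fun t => h * cos t.
  by apply/funext => t; rewrite derive1E (derive_val (is_derive := dF t)).
have cF : continuous F.
  by move=> t; apply/differentiable_continuous/derivable1_diffP; case: (dF t).
have cF' : continuous (fun t : R => h * cos t).
  by move=> t; apply: cvgM; [exact: cvg_cst|exact: continuous_cos].
have pi2 : - (pi / 2) < pi / 2 :> R by rewrite gtrN// divr_gt0// pi_gt0.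
have cG : continuous G.
  move=> x; apply: cvgM; first exact: cvg_cst.
  apply: continuous_cvg; first exact: sqrt_continuous.
  by apply: cvgB; [exact: cvg_cst|exact: exprn_continuous].
rewrite {1}F2 {1}F1 (integration_by_substitution_increasing (G := G)); first last.
- exact: continuous_subspaceT.
- split => [t _||]; first by case: (dF t).
  + by apply: cvg_at_right_filter; exact: cF.
  + by apply: cvg_at_left_filter; exact: cF.
- by rewrite F'E; apply: cvgP; apply: cvg_at_left_filter; exact: cF'.
- by rewrite F'E; apply: cvgP; apply: cvg_at_right_filter; exact: cF'.
- by rewrite F'E => t _; exact: cF'.
- by move=> x y xI yI xy; rewrite /F ltr_pM2l// ltr_sin.
- exact: ltW.
pose K (t : R) := h ^+ 2 * (t + sin t * cos t).
have cK : continuous K.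
  move=> t; apply/differentiable_continuous/derivable1_diffP.
  by case: (half_disc_derivative h t).
transitivity (\int[L]_(t in `[(- (pi / 2))%R, (pi / 2)%R]) (2 * h ^+ 2 * cos t ^+ 2)%:E)%E.
  apply: eq_integral => t; rewrite inE/= in_itv/= => tI; congr EFin.
  rewrite F'E.
  change (2 * Num.sqrt (h ^+ 2 - (h * sin t) ^+ 2) * (h * cos t) = 2 * h ^+ 2 * cos t ^+ 2).
  have -> : h ^+ 2 - (h * sin t) ^+ 2 = (h * cos t) ^+ 2.
    by rewrite !exprMn cos2sin2; ring.
  rewrite sqrtr_sqr ger0_norm; first by ring.
  by rewrite mulr_ge0 ?(ltW h0)// cos_ge0_pihalf.
rewrite (@continuous_FTC2 _ _ K)//.
- rewrite /K sinN cosN cos_pihalf mulr0 -EFinB; congr EFin.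
  by rewrite mulr0 !addr0; field.
- apply: continuous_subspaceT => t; apply: cvgM; first exact: cvg_cst.
  by apply: (@continuous_comp _ _ _ cos (fun x => x ^+ 2)); [exact: continuous_cos|exact: exprn_continuous].
- split => [t _||]; first by case: (half_disc_derivative h t).
  + by apply: cvg_at_right_filter; exact: cK.
  + by apply: cvg_at_left_filter; exact: cK.
- move=> t _; rewrite derive1E.
  by rewrite (derive_val (is_derive := half_disc_derivative h t)).
Qed.

(** Cutting along vertical lines reduces the area to the integral of the chords. *)
Lemma area_disc (a b rho : R) : 0 <= rho ->
  area (disc_at a b rho) = (pi * rho)%:E.
Proof.
move=> rho0.
have chord x : L [set y | (x + a) ^+ 2 + (y + b) ^+ 2 < rho] =
    (2 * Num.sqrt (rho - (x + a) ^+ 2))%:E.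
  set s := Num.sqrt _.
  rewrite (_ : [set y | _] = `](- b - s), (- b + s)[%classic); last first.
    have [le0|gt0] := lerP (rho - (x + a) ^+ 2) 0.
      rewrite /s ler0_sqrtr// subr0 addr0 set_itvoo0; apply/seteqP; split => y //=.
      by have := sqr_ge0 (y + b); lra.
    apply/seteqP; split => y /=; rewrite in_itv/=.
      move=> h; have : `|y + b| < s.
        by rewrite -sqrtr_sqr ltr_sqrt//; lra.
      by rewrite ltr_norml => /andP[h1 h2]; apply/andP; split; lra.
    move=> /andP[h1 h2]; have : `|y + b| < s by rewrite ltr_norml; apply/andP; split; lra.
    by rewrite -sqrtr_sqr ltr_sqrt//; lra.
  rewrite lebesgue_measure_itv/= lte_fin.
  have s0 : 0 <= s by exact: sqrtr_ge0.
  case: ltP => h; rewrite -?EFinB; congr EFin; lra.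
transitivity (\int[L]_x (2 * Num.sqrt (rho - (x + a) ^+ 2))%:E)%E.
  rewrite /area /product_measure1; apply: eq_integral => x _ /=.
  rewrite -chord; congr (L _); apply/seteqP; split => y; first by move/xsectionP.
  by move=> h; apply/xsectionP.
have mf : measurable_fun setT (fun x : R => (2 * Num.sqrt (rho - x ^+ 2))%:E).
  apply/measurable_EFinP; apply: continuous_measurable_fun => x.
  apply: cvgM; first exact: cvg_cst.
  apply: continuous_cvg; first exact: sqrt_continuous.
  by apply: cvgB; [exact: cvg_cst|exact: exprn_continuous].
rewrite (ge0_integral_translation a mf); last first.
  by move=> x; rewrite lee_fin mulr_ge0// sqrtr_ge0.
move: rho0; rewrite le_eqVlt => /predU1P[<-|rho0].
  rewrite mulr0 integral0_eq// => x _; rewrite ler0_sqrtr ?mulr0//.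
  by rewrite sub0r oppr_le0 sqr_ge0.
pose h := Num.sqrt rho.
have h0 : 0 < h by rewrite sqrtr_gt0.
have hE : rho = h ^+ 2 by rewrite sqr_sqrtr// ltW.
rewrite hE -integral_half_chord// [RHS]integral_mkcond/=.
apply: eq_integral => x _; rewrite patchE; case: ifPn => //.
rewrite notin_setE/= in_itv/= => /negP xh; rewrite ler0_sqrtr ?mulr0//.
rewrite subr_le0 leNgt; apply: contra xh => xh.
have : `|x| < h by rewrite -(ltr_pXn2r (n := 2))// ?nnegrE ?(ltW h0)// real_normK// num_real.
by rewrite ltr_norml => /andP[h1 h2]; rewrite !ltW.
Qed.

End disc.

(** * Geometry of the passages *)

Section geometry.
Context (R : realType).
Notation S := (plane R * measurableTypeR R)%type.
Implicit Types z : S.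

(** A point z is the position of a station at time 0 with its direction of
    motion. By sqdist_atE the station is closest to the origin at the time
    passage_time z, and then at the distance `|passage_offset z|. *)
Definition passage_time z : R := - (z.1.1 * cos z.2 + z.1.2 * sin z.2).

Definition passage_offset z : R := z.1.2 * cos z.2 - z.1.1 * sin z.2.

Definition sqdist_at (t : R) z : R :=
  (z.1.1 + t * cos z.2) ^+ 2 + (z.1.2 + t * sin z.2) ^+ 2.

Lemma sqdist_atE t z :
  sqdist_at t z = (t - passage_time z) ^+ 2 + passage_offset z ^+ 2.
Proof.
rewrite /sqdist_at /passage_time /passage_offset.
have := cos2Dsin2 z.2; move: (cos z.2 : R) (sin z.2 : R) => c s /(canRL (addKr _)) cs.
apply/eqP; rewrite -subr_eq0; apply/eqP.
transitivity ((1 - (c ^+ 2 + s ^+ 2)) * (z.1.1 ^+ 2 + z.1.2 ^+ 2 - t ^+ 2)); first by ring.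
by rewrite cs addrC; ring.
Qed.

Lemma sqdist_at_line t z :
  sqdist_at t z = sqdist_at 0 z + t * (2 * (z.1.1 * cos z.2 + z.1.2 * sin z.2)) + t ^+ 2.
Proof. by rewrite !sqdist_atE /passage_time; ring. Qed.

Definition closer_at_passage : set (S * S) :=
  [set zz | sqdist_at (passage_time zz.1) zz.2 < passage_offset zz.1 ^+ 2].

Lemma closer_at_passage_irreflexive z : ~ closer_at_passage (z, z).
Proof. by rewrite /closer_at_passage/= sqdist_atE subrr expr0n/= add0r ltxx. Qed.

Section measurability.

Let mc : measurable_fun setT (cos : R -> R).
Proof. by apply: continuous_measurable_fun; exact: continuous_cos. Qed.

Let ms : measurable_fun setT (sin : R -> R).
Proof. by apply: continuous_measurable_fun; exact: continuous_sin. Qed.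

Let m1 : measurable_fun setT (fun z : S => z.1.1 : R).
Proof. by apply: (@measurableT_comp _ _ _ _ _ _ fst). Qed.

Let m2 : measurable_fun setT (fun z : S => z.1.2 : R).
Proof. by apply: (@measurableT_comp _ _ _ _ _ _ snd). Qed.

Let mcos : measurable_fun setT (fun z : S => cos z.2 : R).
Proof. exact: measurableT_comp. Qed.

Let msin : measurable_fun setT (fun z : S => sin z.2 : R).
Proof. exact: measurableT_comp. Qed.

Lemma measurable_passage_time : measurable_fun setT passage_time.
Proof.
apply: measurableT_comp => //.
by apply: measurable_funD; exact: measurable_funM.
Qed.

Lemma measurable_passage_offset : measurable_fun setT passage_offset.
Proof. by apply: measurable_funB; exact: measurable_funM. Qed.

Lemma measurable_sqdist_at t : measurable_fun setT (sqdist_at t).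
Proof.
apply: measurable_funD; apply: measurable_funX; apply: measurable_funD => //;
  exact: measurable_funM.
Qed.

End measurability.

Definition rational_triple (k : nat) : R * R * R :=
  if (choice.unpickle k : option (rat * rat * rat)) is Some p
  then (ratr p.1.1, ratr p.1.2, ratr p.2) else (0, 0, 0).

(** By sqdist_at_line, z' is closer at the passage of z exactly when the affine
    function t |-> sqdist_at t z' - t ^+ 2 is less than passage_offset z ^+ 2 -
    passage_time z ^+ 2 at t = passage_time z. This holds as soon as it is less
    than - p3 at two times p1 and p2 around passage_time z, for some - p3 below that bound. *)
Definition early_window (k : nat) : set S :=
  [set z | [/\ (rational_triple k).1.1 < passage_time z,
    passage_time z < (rational_triple k).1.2 &
    passage_time z ^+ 2 - passage_offset z ^+ 2 < (rational_triple k).2]].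

Definition near_window (k : nat) : set S :=
  [set z | sqdist_at (rational_triple k).1.1 z < (rational_triple k).1.1 ^+ 2 - (rational_triple k).2 /\
    sqdist_at (rational_triple k).1.2 z < (rational_triple k).1.2 ^+ 2 - (rational_triple k).2].

Lemma closer_at_passage_rectangles :
  closer_at_passage = \bigcup_k (early_window k `*` near_window k).
Proof.
apply/seteqP; split => [[z z']|[z z'] [k _]]; last first.
  rewrite /closer_at_passage /early_window /near_window/=.
  move: (rational_triple k) => [[p1 p2] p3] /= [[h1 h2 h3] [h4 h5]].
  rewrite sqdist_at_line.
  move: h4 h5; rewrite (sqdist_at_line p1) (sqdist_at_line p2).
  set a := sqdist_at 0 z'; set b := 2 * _.
  set T := passage_time z in h1 h2 h3 *; move=> h4 h5.
  have h6 : (p2 - T) * (a + p1 * b + p3) < 0 by rewrite pmulr_rlt0; lra.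
  have h7 : (T - p1) * (a + p2 * b + p3) < 0 by rewrite pmulr_rlt0; lra.
  have h8 : (p2 - p1) * (a + T * b + p3) < 0.
    have -> : (p2 - p1) * (a + T * b + p3) =
      (p2 - T) * (a + p1 * b + p3) + (T - p1) * (a + p2 * b + p3) by ring.
    lra.
  have : a + T * b + p3 < 0 by rewrite pmulr_rlt0 in h8; lra.
  by lra.
rewrite /closer_at_passage/= sqdist_at_line.
set a := sqdist_at 0 z'; set b := 2 * _; set T := passage_time z.
set q := passage_offset z => h.
(* Here e is half of the slack in h. One half is left to the choice of p3, the
   other to the variation of t |-> a + t * b between T - n and T + n. *)
pose e := (q ^+ 2 - T ^+ 2 - (a + T * b)) / 2.
have e0 : 0 < e by rewrite divr_gt0//; lra.
have b1 : 0 < `|b| + 1 by rewrite ltr_wpDl.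
pose n := e / (`|b| + 1).
have n0 : 0 < n by rewrite divr_gt0.
have nb : n * `|b| < e.
  have -> : e = n * (`|b| + 1) by rewrite /n divfK// gt_eqF.
  by rewrite mulrDr mulr1 ltrDl.
have [p3] : exists p, ratr p \in `](T ^+ 2 - q ^+ 2), (T ^+ 2 - q ^+ 2 + e)[ by apply: rat_in_itvoo; rewrite ltrDl.
have [p1] : exists p, ratr p \in `](T - n), T[ by apply: rat_in_itvoo; rewrite gtrBl.
have [p2] : exists p, ratr p \in `]T, (T + n)[ by apply: rat_in_itvoo; rewrite ltrDl.
rewrite !in_itv/= => /andP[h21 h22] /andP[h11 h12] /andP[h31 h32].
have near_T p : `|p - T| < n -> a + p * b < a + T * b + e.
  move=> pT; have : (p - T) * b <= n * `|b|.
    apply: (le_trans (ler_norm _)); rewrite normrM ler_wpM2r// ltW//.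
  by move: nb; nra.
have {}near1 := near_T (ratr p1); have {}near2 := near_T (ratr p2).
have E1 : a + ratr p1 * b < a + T * b + e by apply: near1; rewrite ltr_norml; apply/andP; split; lra.
have E2 : a + ratr p2 * b < a + T * b + e by apply: near2; rewrite ltr_norml; apply/andP; split; lra.
have eE : 2 * e = q ^+ 2 - T ^+ 2 - (a + T * b) by rewrite /e; field.
exists (choice.pickle (p1, p2, p3)) => //; rewrite /early_window /near_window /rational_triple choice.pickleK/=.
split => /=; first by [].
rewrite (sqdist_at_line (ratr p1)) (sqdist_at_line (ratr p2)) -/a -/b.
split; lra.
Qed.

Lemma measurable_early_window k : measurable (early_window k).
Proof.
have mT := measurable_passage_time; have mq := measurable_passage_offset.
rewrite (_ : early_window k = passage_time @^-1` `](rational_triple k).1.1, (rational_triple k).1.2[ `&`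
   (fun z => passage_time z ^+ 2 - passage_offset z ^+ 2) @^-1` `]-oo, (rational_triple k).2[).
  apply: measurableI; rewrite -[X in measurable X]setTI.
    by apply: mT.
  have : measurable_fun setT (fun z => passage_time z ^+ 2 - passage_offset z ^+ 2).
    by apply: measurable_funB; exact: measurable_funX.
  by apply.
apply/seteqP; split => z; rewrite /early_window /= !in_itv/=.
  by move=> [-> -> ->].
by move=> [/andP[-> ->] ->].
Qed.

Lemma measurable_sqdist_lt t rho : measurable [set z | sqdist_at t z < rho].
Proof.
rewrite (_ : [set z | _] = sqdist_at t @^-1` `]-oo, rho[).
  by rewrite -[X in measurable X]setTI; apply: measurable_sqdist_at.
by apply/seteqP; split => z; rewrite /= in_itv.
Qed.

Lemma measurable_near_window k : measurable (near_window k).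
Proof. by apply: measurableI; exact: measurable_sqdist_lt. Qed.

Lemma early_near_window k : early_window k `&` near_window k = set0.
Proof.
apply/seteqP; split => z // [Az Bz]; apply: (@closer_at_passage_irreflexive z).
by rewrite closer_at_passage_rectangles; exists k.
Qed.

Lemma measurable_closer_at_passage : measurable closer_at_passage.
Proof.
rewrite closer_at_passage_rectangles; apply: bigcup_measurable => k _.
by apply: measurableX; [exact: measurable_early_window|exact: measurable_near_window].
Qed.

End geometry.

(** * The intensity of the marked process *)

Section sigma_finiteness.
Context (R : realType).
Local Open Scope ereal_scope.

Lemma sigma_finite_product d1 (T1 : measurableType d1) d2 (T2 : measurableType d2)
    (m1 : {sigma_finite_measure set T1 -> \bar R})
    (m2 : {sigma_finite_measure set T2 -> \bar R}) : sigma_finite setT (m1 \x m2).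
Proof.
have /sigma_finiteP[F [TF ndF Foo]] := sigma_finiteT m1.
have /sigma_finiteP[G [TG ndG Goo]] := sigma_finiteT m2.
exists (fun n => F n `*` G n) => [|k].
  apply/esym/seteqP; split => // -[x y] _.
  have [n _ Fx] : (\bigcup_i F i) x by rewrite -TF.
  have [k _ Gy] : (\bigcup_i G i) y by rewrite -TG.
  exists (maxn n k) => //; split => /=.
    by move: Fx; apply/subsetPset/ndF/leq_maxl.
  by move: Gy; apply/subsetPset/ndG/leq_maxr.
have [mF Fk] := Foo k; have [mG Gk] := Goo k.
split; first exact: measurableX.
by rewrite product_measure1E// lte_mul_pinfty// ge0_fin_numE.
Qed.

Lemma sigma_finite_mscale d (T : measurableType d) (l : {nonneg R})
    (m : {sigma_finite_measure set T -> \bar R}) : sigma_finite setT (mscale l m).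
Proof.
have [F TF Foo] := sigma_finiteT m; exists F => // k; have [mF Fk] := Foo k.
by split => //; rewrite /mscale/= lte_mul_pinfty// ?lee_fin.
Qed.

End sigma_finiteness.

HB.instance Definition _ (R : realType) := Measure.on (@area R).
HB.instance Definition _ (R : realType) := Measure_isSigmaFinite.Build _ _ _
  (@area R) (sigma_finite_product (@lebesgue_measure R) (@lebesgue_measure R)).

Definition angle_law (R : realType) : probability (measurableTypeR R) R :=
  uniform_prob (@ltNpipi R).

Definition intensity_measure (R : realType) (l : {nonneg R}) :
  set (plane R) -> \bar R := mscale l (@area R).

HB.instance Definition _ (R : realType) (l : {nonneg R}) :=
  Measure.on (intensity_measure l).
HB.instance Definition _ (R : realType) (l : {nonneg R}) :=
  Measure_isSigmaFinite.Build _ _ _ (intensity_measure l)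
    (sigma_finite_mscale l (@area R)).

Definition marked_intensity (R : realType) (l : {nonneg R}) :
    set (plane R * measurableTypeR R) -> \bar R :=
  (intensity_measure l \x angle_law R)%E.

HB.instance Definition _ (R : realType) (l : {nonneg R}) :=
  Measure.on (marked_intensity l).
HB.instance Definition _ (R : realType) (l : {nonneg R}) :=
  Measure_isSigmaFinite.Build _ _ _ (marked_intensity l)
    (sigma_finite_product (intensity_measure l) (angle_law R)).

Section marked_intensity.
Context (R : realType) (l : {nonneg R}).
Local Notation L := (@lebesgue_measure R).
Local Notation nu := (intensity_measure l).
Local Notation mu := (marked_intensity l).
Local Notation U := (angle_law R).
Notation S := (plane R * measurableTypeR R)%type.
Local Open Scope ereal_scope.

Lemma marked_tonelli1 (f : S -> \bar R) : measurable_fun setT f -> (forall z, 0 <= f z) ->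
  \int[mu]_z f z = \int[nu]_x \int[U]_t f (x, t).
Proof. exact: (@fubini_tonelli1 _ _ _ _ R nu U f). Qed.

Lemma marked_tonelli2 (f : S -> \bar R) : measurable_fun setT f -> (forall z, 0 <= f z) ->
  \int[mu]_z f z = \int[U]_t \int[nu]_x f (x, t).
Proof. exact: (@fubini_tonelli2 _ _ _ _ R nu U f). Qed.

Lemma integral_intensity_measure (f : plane R -> \bar R) : measurable_fun setT f ->
  (forall x, 0 <= f x) ->
  \int[nu]_x f x = l%:num%:E * \int[@area R]_x f x.
Proof. by move=> mf f0; rewrite ge0_integral_mscale. Qed.

Lemma integral_uniform_cst (a : R) : \int[U]_t a%:E = a%:E.
Proof.
rewrite integral_cst//= -[RHS]mule1; congr (_ * _).
exact: (probability_setT U).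
Qed.

(** For each direction of motion the positions form a disc centered at the
    displacement during the time t, so the area does not depend on the direction. *)
Lemma marked_intensity_sqdist (t rho : R) : (0 <= rho)%R ->
  mu [set z | (sqdist_at t z < rho)%R] = (l%:num * (pi * rho))%:E.
Proof.
move=> rho0; have mE := measurable_sqdist_lt t rho.
rewrite -[X in mu X]setIT -integral_indic// marked_tonelli2//; last first.
  by apply/measurable_EFinP; exact: measurable_indic.
rewrite -[RHS]integral_uniform_cst; apply: eq_integral => s _.
rewrite (_ : (fun x => _) = fun x => (\1_(disc_at (t * cos s) (t * sin s) rho) x)%:E); last first.
  by apply/funext => x; rewrite !indicE; congr (_ %:R%:E); apply/idP/idP => /set_mem h; exact/mem_set.
have mD : measurable (disc_at (t * cos s) (t * sin s) rho).
  rewrite (_ : disc_at _ _ _ = (fun x : plane R => (x, s)) @^-1` [set z | (sqdist_at t z < rho)%R])//.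
  rewrite -[X in measurable X]setTI; have : measurable_fun setT (fun x : plane R => (x, s) : S) by exact: measurable_fun_pair.
  by apply.
rewrite integral_intensity_measure//; last first.
  by apply/measurable_EFinP; exact: measurable_indic.
rewrite integral_indic// setIT EFinM; congr (_ * _).
exact: area_disc.
Qed.

Lemma marked_intensity_near_window k : mu (near_window k) < +oo.
Proof.
set p := rational_triple R k.
pose rho := (`|p.1.1 ^+ 2 - p.2|)%R.
apply: (@le_lt_trans _ _ (mu [set z | (sqdist_at p.1.1 z < rho)%R])).
  apply: le_measure; rewrite ?inE; [exact: measurable_near_window|exact: measurable_sqdist_lt|].
  by move=> z [h _]; apply: (lt_le_trans h); exact: ler_norm.
by rewrite marked_intensity_sqdist ?normr_ge0// ltry.
Qed.

Lemma xsection_closer_at_passage z :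
  mu (xsection (@closer_at_passage R) z) =
  (l%:num * (pi * passage_offset z ^+ 2))%:E.
Proof.
transitivity (mu [set y | (sqdist_at (passage_time z) y < passage_offset z ^+ 2)%R]).
  congr (mu _); apply/seteqP; split => y; first by move/xsectionP.
  by move=> h; apply/xsectionP.
exact: (marked_intensity_sqdist _ (sqr_ge0 _)).
Qed.


Lemma measurable_expN_sqr (k : R) :
  measurable_fun setT (fun y : R => (expR (- (k * y ^+ 2)))%:E).
Proof.
apply/measurable_EFinP; apply: continuous_measurable_fun => y.
apply: continuous_comp; last exact: continuous_expR.
by apply: cvgN; apply: cvgM; [exact: cvg_cst|exact: exprn_continuous].
Qed.

Lemma integral_gauss_scaled (k : R) : (0 < k)%R ->
  \int[L]_y (expR (- (k * y ^+ 2)))%:E = (Num.sqrt (pi / k))%:E.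
Proof.
move=> k0; pose s : R := Num.sqrt ((2 * k)^-1).
have s2 : (s ^+ 2 = (2 * k)^-1)%R by rewrite sqr_sqrtr// invr_ge0 mulr_ge0// ltW.
have s0 : (s != 0)%R by rewrite gt_eqF// sqrtr_gt0 invr_gt0 mulr_gt0.
have peak : (normal_peak s = (Num.sqrt (pi / k))^-1)%R.
  rewrite /normal_peak s2; congr ((Num.sqrt _)^-1)%R.
  by rewrite -mulr_natl; field; rewrite gt_eqF.
have q0 : (0 < Num.sqrt (pi / k))%R by rewrite sqrtr_gt0 divr_gt0// pi_gt0.
have : \int[L]_y (normal_pdf 0 s y)%:E =
    \int[L]_y (((Num.sqrt (pi / k))^-1)%:E * (expR (- (k * y ^+ 2)))%:E).
  apply: eq_integral => y _; rewrite normal_pdfE// peak EFinM /normal_fun subr0.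
  congr (_ * (expR _)%:E).
  by rewrite s2 -mulr_natl; field; rewrite gt_eqF.
rewrite integral_normal_pdf.
rewrite ge0_integralZl//; last exact: measurable_expN_sqr.
move=> h; rewrite -[RHS]mule1 h muleA -EFinM divff ?gt_eqF// mul1e//.
Qed.

Definition passage_window : set S := @passage_time R @^-1` `[0%R, 1%R].

Lemma measurable_passage_window : measurable passage_window.
Proof. by rewrite -[X in measurable X]setTI; apply: measurable_passage_time. Qed.

(** For a fixed direction s, the rotation by - s maps the position to (- t, q),
    with t the passage time and q the offset. It preserves the area, so the
    integral splits into the length of the time window and a Gaussian integral. *)
Lemma mean_sum_passage (r : R) : (0 < l%:num)%R -> (0 <= r < 1)%R ->
  mean_sum mu r passage_window (@closer_at_passage R) =
  (Num.sqrt l%:num / Num.sqrt (1 - r))%:E.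
Proof.
move=> l0 /andP[r0 r1]; set k : R := ((1 - r) * (l%:num * pi))%R.
have k0 : (0 < k)%R by rewrite !mulr_gt0 ?subr_gt0 ?pi_gt0.
pose g (p : plane R) : \bar R :=
  ((\1_`[(-1)%R, 0%R] p.1)%:E * (expR (- (k * p.2 ^+ 2)))%:E).
have mexp := measurable_expN_sqr k.
have mg : measurable_fun setT g.
  apply: emeasurable_funM.
    apply/measurable_EFinP; apply: (@measurableT_comp _ _ _ _ _ _ (\1_`[(-1)%R, 0%R] : R -> R)) => //.
  exact: (measurableT_comp mexp).
have g0 p : 0 <= g p by rewrite /g -EFinM lee_fin mulr_ge0// expR_ge0.
have gE x s : (\1_passage_window (x, s) * void_weight mu r (@closer_at_passage R) (x, s))%:E =
    g (rotate (cos s) (sin s) x).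
  rewrite /g /rotate/= -EFinM; congr (_ * _)%:E.
    rewrite !indicE; congr (nat_of_bool _)%:R%R; apply/idP/idP => /set_mem/=;
      rewrite /passage_window/passage_time/= in_itv/= => /andP[h1 h2];
      apply/mem_set; rewrite /= /passage_window/passage_time/= in_itv/=; apply/andP; split; lra.
  rewrite /void_weight [X in fine X](_ : _ = (l%:num * (pi * passage_offset (x, s) ^+ 2))%:E);
    last exact: xsection_closer_at_passage.
  congr (expR (- _)).
  by rewrite /passage_offset/= /k; ring.
rewrite /mean_sum marked_tonelli2; last 2 first.
- apply/measurable_EFinP; apply: measurable_funM; last first.
    by apply: measurable_void_weight; exact: measurable_closer_at_passage.
  by apply: measurable_indic; exact: measurable_passage_window.
- by move=> z; rewrite lee_fin mulr_ge0// void_weight_ge0.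
rewrite -[RHS]integral_uniform_cst; apply: eq_integral => s _.
rewrite (eq_integral (fun x => g (rotate (cos s) (sin s) x))); last first.
  by move=> x _; exact: gE.
rewrite integral_intensity_measure; last 2 first.
- by apply: (measurableT_comp mg); exact: measurable_rotate.
- by move=> x; exact: g0.
rewrite ge0_integral_rotate//; last exact: cos2Dsin2.
rewrite (area_tonelli1 mg g0) /g/=.
rewrite (eq_integral (fun x : measurableTypeR R => (\1_`[(-1)%R, 0%R] (x : R))%:E * (Num.sqrt (pi / k))%:E)); last first.
  by move=> x _; rewrite ge0_integralZl// integral_gauss_scaled.
rewrite ge0_integralZr//; last first.
  by apply/measurable_EFinP; exact: measurable_indic.
have L1 : L `[(-1)%R, 0%R] = 1.
  by rewrite lebesgue_measure_itv/= lte_fin ltrN10 -EFinB opprK add0r.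
rewrite integral_indic// setIT [X in (_ * (X * _))%E](_ : _ = 1)// mul1e -EFinM; congr EFin.
have -> : (pi / k = (l%:num * (1 - r))^-1)%R.
  have := pi_gt0 R; rewrite /k; move: (pi : R) => c c0; field.
  by rewrite !gt_eqF ?subr_gt0.
rewrite sqrtrV ?mulr_ge0 ?subr_ge0 ?(ltW r1)// sqrtrM//.
have sl : (0 < Num.sqrt l%:num)%R by rewrite sqrtr_gt0.
have sr : (0 < Num.sqrt (1 - r))%R by rewrite sqrtr_gt0 subr_gt0.
rewrite -{1}(sqr_sqrtr (ltW l0)); field.
by rewrite !gt_eqF.
Qed.

End marked_intensity.

(** * Extracting the coefficient of r *)

Section coefficient.
Context (R : realType).

Definition singleton_indicator (E : set nat) : R := (`[< exists! j, E j >])%:R.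

Lemma singleton_indicator_finite (E : set nat) : finite_set E ->
  exists2 m, counting E = m%:R%:E :> \bar R & singleton_indicator E = (m == 1)%:R.
Proof.
move=> fE; exists #|` fset_set E|; first by rewrite /counting asboolT.
rewrite /singleton_indicator; congr (nat_of_bool _)%:R; apply/asboolP/idP.
  move=> [j [Ej uj]]; have -> : E = [set j].
    by apply/seteqP; split => [k Ek|_ -> //]; rewrite (uj _ Ek).
  by rewrite fset_set1 cardfs1.
move=> /cardfs1P[j Ej]; exists j.
have EE : E = [set j] by rewrite -(fset_setK fE) Ej set_fset1.
by rewrite EE; split => // k ->.
Qed.

Lemma singleton_indicator_infinite (E : set nat) : infinite_set E ->
  singleton_indicator E = 0.
Proof.
move=> iE; rewrite /singleton_indicator asboolF// => -[j [Ej uj]]; apply: iE.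
rewrite (_ : E = [set j]); first exact: finite_set1.
by apply/seteqP; split => [k Ek|_ -> //]; rewrite (uj _ Ek).
Qed.

(** Let N be the cardinal of E. The number r ^ N - 0 ^ N is r if N = 1, and it
    is at most r ^ 2 * (1 / 2) ^ (N - 2) if N > 1. *)
Lemma pow_card_coefficient (r : R) (E : set nat) : 0 < r <= 1 / 2 ->
  r * singleton_indicator E + pow_card 0 E <= pow_card r E <=
  r * singleton_indicator E + pow_card 0 E + 4 * r ^+ 2 * pow_card (1 / 2) E.
Proof.
move=> /andP[r0 r2]; have [fE|iE] := pselect (finite_set E); last first.
  rewrite singleton_indicator_infinite// !pow_card_infinite//; last 3 first.
  - by apply/andP; split; lra.
  - by apply/andP; split; lra.
  - by rewrite lexx ltr01.
  by rewrite !mulr0 !addr0 lexx.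
have [m Em ->] := singleton_indicator_finite fE.
rewrite !(pow_card_nat _ Em); case: m {Em} => [|[|m]].
- by rewrite !expr0 mulr0 add0r mulr1 lexx/= lerDl mulr_ge0// exprn_ge0// ltW.
- by rewrite !expr1 mulr1 addr0 lexx/= lerDl !mulr_ge0// ?exprn_ge0// ltW.
rewrite expr0n/= mulr0 !add0r exprn_ge0/=; last exact: ltW.
rewrite [leLHS](_ : _ = r ^+ 2 * r ^+ m); last by rewrite -exprD.
rewrite [leRHS](_ : _ = r ^+ 2 * (1 / 2) ^+ m); last first.
  by rewrite -[m.+2]addn2 exprD; field.
rewrite ler_wpM2l ?exprn_ge0 ?(ltW r0)//.
by apply: lerXn2r; rewrite ?nnegrE//; lra.
Qed.

Lemma invr_sqrt_onem_bounds (r : R) : 0 < r <= 1 / 2 ->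
  r / 2 <= 1 / Num.sqrt (1 - r) - 1 <= r / 2 + 3 * r ^+ 2.
Proof.
move=> /andP[r0 r2]; set s := Num.sqrt (1 - r).
have r1 : 0 <= 1 - r by lra.
have s2 : s ^+ 2 = 1 - r by rewrite sqr_sqrtr.
have s0 : 0 <= s by exact: sqrtr_ge0.
have s_gt : 1 / 2 < s by rewrite ltNge; apply/negP => h; nra.
have s_le : s <= 1 by rewrite leNgt; apply/negP => h; nra.
have sn0 : s != 0 by rewrite gt_eqF//; lra.
have -> : 1 / s - 1 = (1 - s) / s by field.
have -> : r = (1 - s) * (1 + s) by rewrite -[LHS](subKr 1) -s2; ring.
rewrite ler_pdivlMr; last by lra.
rewrite ler_pdivrMr; last by lra.
apply/andP; split.
  rewrite -subr_ge0 (_ : _ - _ = (1 - s) * ((1 - s) * (2 + s)) / 2); last by field.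
  by rewrite divr_ge0// !mulr_ge0//; lra.
rewrite -subr_ge0.
rewrite (_ : _ - _ = (1 - s) ^+ 2 * (3 * (1 + s) ^+ 2 * s - (2 + s) / 2)); last by field.
rewrite mulr_ge0 ?exprn_ge0//; nra.
Qed.

End coefficient.

Section extraction.
Context d (Omega : measurableType d) (R : realType) (P : probability Omega R).
Variables (c : nat -> Omega -> R) (E : nat -> Omega -> set nat) (k : R).
Hypothesis k0 : 0 <= k.
Hypothesis c01 : forall i, unit_interval_valued (c i).
Hypothesis E01 : forall i (r : R), 0 <= r <= 1 ->
  unit_interval_valued (fun w => pow_card r (E i w)).
Hypothesis sum_pow_card : forall r : R, 0 <= r < 1 ->
  (\sum_(i <oo) \int[P]_w (c i w * pow_card r (E i w))%:E)%E =
  (k / Num.sqrt (1 - r))%:E.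

(** The indicator is the limit of (r ^ N - 0 ^ N) / r as r tends to 0, with N
    the cardinal of E i w, and hence measurable. *)
Lemma unit_interval_valued_singleton i :
  unit_interval_valued (fun w => singleton_indicator R (E i w) : R).
Proof.
pose e n : R := (n.+2%:R)^-1.
have e0 n : 0 < e n by rewrite invr_gt0.
have e2 n : e n <= 1 / 2.
  by rewrite div1r lef_pV2 ?posrE// ler_nat.
have e01 n : 0 <= e n <= 1 by rewrite ltW//=; have := e2 n; lra.
split; last first.
  by move=> w; rewrite /singleton_indicator ler0n lern1 leq_b1.
apply: (@measurable_fun_limit _ _ _ (fun n w =>
    (e n)^-1 * (pow_card (e n) (E i w) - pow_card 0 (E i w)))).
  move=> n; apply: measurable_funM => //; apply: measurable_funB.
    by case: (E01 i (e01 n)).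
  by case: (@E01 i 0) => //; rewrite lexx ler01.
move=> w; have e_cvg : 4 * e n @[n --> \oo] --> 0.
  rewrite -[X in _ --> X](mulr0 4); apply: cvgM; first exact: cvg_cst.
  by have := @cvg_harmonic R; rewrite -cvg_shiftS.
apply/cvgrPdist_le => eps eps0.
have /cvgrPdist_le/(_ eps eps0) := e_cvg.
apply: filterS => n; rewrite sub0r normrN ger0_norm; last first.
  by rewrite mulr_ge0// ltW.
move=> en; have e02 : 0 < e n <= 1 / 2 by rewrite e0 e2.
have /andP[h1 h2] := pow_card_coefficient (E i w) e02.
set u := singleton_indicator R (E i w) in h1 h2 *.
set x := pow_card (e n) (E i w) - _.
have x1 : e n * u <= x by rewrite /x; lra.
have x2 : x <= e n * u + 4 * e n ^+ 2.
  have half01 : 0 <= (1 / 2 : R) <= 1 by apply/andP; split; lra.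
  have p1 := pow_card_le1 (E i w) half01; rewrite /x; have := sqr_ge0 (e n); nra.
rewrite distrC ger0_norm; last first.
  by rewrite subr_ge0 ler_pdivlMl.
apply: le_trans en; rewrite lerBlDr ler_pdivrMl//.
by move: x2; rewrite expr2; lra.
Qed.

(** Summing pow_card_coefficient, k / sqrt (1 - r) - k equals r times the left
    side up to an error of order r ^ 2. Divide by r and let r tend to 0. *)
Lemma expected_singletons :
  (\sum_(i <oo) \int[P]_w (c i w * singleton_indicator R (E i w))%:E)%E = (k / 2)%:E.
Proof.
have u01 i : unit_interval_valued (fun w => c i w * singleton_indicator R (E i w)).
  by apply: unit_interval_valuedM => //; exact: unit_interval_valued_singleton.
have p01 r i : 0 <= r <= 1 -> unit_interval_valued (fun w => c i w * pow_card r (E i w)).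
  by move=> r01; apply: unit_interval_valuedM => //; exact: E01.
pose f (h : nat -> Omega -> R) := (\sum_(i <oo) \int[P]_w (h i w)%:E)%E.
pose u i w := c i w * singleton_indicator R (E i w).
pose p r i w := c i w * pow_card r (E i w).
pose nonneg (h : nat -> Omega -> R) :=
  (forall i, measurable_fun setT (h i)) /\ (forall i w, 0 <= h i w).
have int0 h i : nonneg h -> (0 <= \int[P]_w (h i w)%:E)%E.
  by move=> [_ h0]; apply: integral_ge0 => w _; rewrite lee_fin.
have fZ a h : 0 <= a -> nonneg h -> f (fun i w => a * h i w) = (a%:E * f h)%E.
  move=> a0 h0; rewrite /f -nneseriesZl//; last by move=> i _; exact: int0.
  apply: eq_eseriesr => i _; rewrite -ge0_integralZl ?lee_fin//.
  - by apply/measurable_EFinP; case: h0.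
  - by move=> w _; rewrite lee_fin; case: h0.
have fD h g : nonneg h -> nonneg g -> f (fun i w => h i w + g i w) = (f h + f g)%E.
  move=> h0 g0; rewrite /f -nneseriesD; last 2 first.
  - by move=> i _ _; exact: int0.
  - by move=> i _ _; exact: int0.
  apply: eq_eseriesr => i _; rewrite -ge0_integralD//.
  - by move=> w _; rewrite lee_fin; case: h0.
  - by apply/measurable_EFinP; case: h0.
  - by move=> w _; rewrite lee_fin; case: g0.
  - by apply/measurable_EFinP; case: g0.
have nonnegD h g : nonneg h -> nonneg g -> nonneg (fun i w => h i w + g i w).
  move=> [mh h0] [mg g0]; split => [i|i w]; first exact: measurable_funD.
  by rewrite addr_ge0.
have nonnegZ a h : 0 <= a -> nonneg h -> nonneg (fun i w => a * h i w).
  move=> a0 [mh h0]; split => [i|i w]; first exact: measurable_funM.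
  by rewrite mulr_ge0.
have fle h g : nonneg h -> nonneg g -> (forall i w, h i w <= g i w) -> (f h <= f g)%E.
  move=> h0 g0 hg; apply: lee_nneseries => [i _ _|i _]; first exact: int0.
  apply: ge0_le_integral => //.
  - by move=> w _; rewrite lee_fin; case: h0.
  - by apply/measurable_EFinP; case: h0.
  - by apply/measurable_EFinP; case: g0.
  - by move=> w _; rewrite lee_fin.
have u0 : nonneg u.
  by split => [i|i w]; case: (u01 i) => // _ /(_ w)/andP[].
have p0 r : 0 <= r <= 1 -> nonneg (p r).
  by move=> r01; split => [i|i w]; case: (p01 r i r01) => // _ /(_ w)/andP[].
have c0 i w : 0 <= c i w by case: (c01 i) => _ /(_ w)/andP[].
have r00 : 0 <= (0 : R) <= 1 by rewrite lexx ler01.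
have rh : 0 <= (1 / 2 : R) <= 1 by apply/andP; split; lra.
pose half : R := k / Num.sqrt (1 - 1 / 2).
have half0 : 0 <= half by rewrite divr_ge0// sqrtr_ge0.
have f0 : f (p 0) = k%:E.
  by rewrite /f /p sum_pow_card ?lexx ?ltr01// subr0 sqrtr1 divr1.
have fhalf : f (p (1 / 2)) = half%:E.
  by rewrite /f /p sum_pow_card//; apply/andP; split; lra.
have fp r : 0 < r <= 1 / 2 -> f (p r) = (k / Num.sqrt (1 - r))%:E.
  by move=> /andP[r0 r2]; rewrite /f /p sum_pow_card//; apply/andP; split; lra.
have lower r : 0 < r <= 1 / 2 ->
    (r%:E * f u + k%:E <= (k / Num.sqrt (1 - r))%:E)%E.
  move=> r02; have /andP[r0 r2] := r02.
  have r01 : 0 <= r <= 1 by apply/andP; split; lra.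
  have ru := nonnegZ r u (ltW r0) u0.
  rewrite -fp// -f0 -(fZ _ _ (ltW r0) u0) -fD//; last exact: p0.
  apply: fle => [||i w]; [exact/nonnegD/p0|exact: p0|].
  have /andP[h1 _] := pow_card_coefficient (E i w) r02.
  by rewrite /u /p mulrCA -mulrDr; exact: ler_wpM2l.
have upper r : 0 < r <= 1 / 2 ->
    ((k / Num.sqrt (1 - r))%:E <= r%:E * f u + k%:E + (4 * r ^+ 2 * half)%:E)%E.
  move=> r02; have /andP[r0 r2] := r02.
  have r01 : 0 <= r <= 1 by apply/andP; split; lra.
  have q0 : 0 <= 4 * r ^+ 2 by rewrite mulr_ge0// exprn_ge0// ltW.
  have ru := nonnegZ r u (ltW r0) u0.
  have rup : nonneg (fun i w => r * u i w + p 0 i w) by exact/nonnegD/p0.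
  have qp := nonnegZ _ _ q0 (p0 _ rh).
  rewrite -fp// EFinM -fhalf -f0 -(fZ _ _ (ltW r0) u0) -(fZ _ _ q0 (p0 _ rh)) -fD//; last exact: p0.
  rewrite -fD//; apply: fle => [||i w]; [exact: p0|exact: nonnegD|].
  have /andP[_ h1] := pow_card_coefficient (E i w) r02.
  by rewrite /u /p mulrCA -mulrDr [_ * (c i w * _)]mulrCA -mulrDr; exact: ler_wpM2l.
have f_ge0 : (0 <= f u)%E by apply: nneseries_ge0 => i _ _; exact: int0.
have fin_f : f u \is a fin_num.
  rewrite ge0_fin_numE//.
  have : ((1 / 2)%:E * f u < +oo)%E.
    apply: le_lt_trans (ltry (k / Num.sqrt (1 - 1 / 2))).
    apply: le_trans (lower _ _); last by apply/andP; split; lra.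
    by rewrite leeDl// lee_fin.
  by rewrite !ltey; apply: contra_neq => ->; rewrite gt0_muley// lte_fin; lra.
rewrite -/(f u) -(fineK fin_f); congr EFin.
move: (fine (f u)) (fineK fin_f) => x xE; rewrite -xE in lower upper.
have bounds r : 0 < r <= 1 / 2 ->
    r * x <= r * (k / 2 + 3 * k * r) /\ r * (k / 2) <= r * (x + 4 * half * r).
  move=> r02; have /andP[b1 b2] := invr_sqrt_onem_bounds r02.
  have := lower r r02; have := upper r r02.
  rewrite -!EFinM -!EFinD !lee_fin => h1 h2.
  have b1' : k * (r / 2) <= k * (1 / Num.sqrt (1 - r) - 1) by exact: ler_wpM2l.
  have b2' : k * (1 / Num.sqrt (1 - r) - 1) <= k * (r / 2 + 3 * r ^+ 2) by exact: ler_wpM2l.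
  have kE : k / Num.sqrt (1 - r) = k * (1 / Num.sqrt (1 - r)) by rewrite div1r.
  rewrite kE in h1 h2; move: (1 / _) h1 h2 b1' b2' => y h1 h2 b1' b2'.
  by split; lra.
have half_e e : 0 < e <= 1 -> 0 < e / 2 <= (1 / 2 : R).
  by move=> /andP[e0 e1]; apply/andP; split; lra.
apply/eqP; rewrite eq_le; apply/andP; split.
- apply: (@ler_linear_error _ _ _ (3 * k)) => [|e e01]; first by rewrite mulr_ge0.
  have [h _] := bounds _ (half_e _ e01); have /andP[e0 e1] := e01.
  rewrite ler_pM2l in h; last by lra.
  by apply: (le_trans h); rewrite lerD2l; have := mulr_ge0 k0 (ltW e0); lra.
- apply: (@ler_linear_error _ _ _ (4 * half)) => [|e e01]; first by rewrite mulr_ge0.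
  have [_ h] := bounds _ (half_e _ e01); have /andP[e0 e1] := e01.
  rewrite ler_pM2l in h; last by lra.
  by apply: (le_trans h); rewrite lerD2l; have := mulr_ge0 half0 (ltW e0); lra.
Qed.

End extraction.

(** * The network *)

Section network.
Context (Omega : Type) (R : realType).
Variables (X : nat -> Omega -> plane R) (Th : nat -> Omega -> R).
Notation S := (plane R * measurableTypeR R)%type.

Definition station (i : nat) (w : Omega) : S := (X i w, Th i w).

Lemma user_distE i t w :
  user_dist 1 X Th i t w = Num.sqrt (sqdist_at t (station i w)).
Proof. by rewrite /user_dist /euclidean_norm /position /sqdist_at/= !mul1r. Qed.

Lemma closest_timeE i w : closest_time 1 X Th i w = passage_time (station i w).
Proof.
rewrite /closest_time; set A := [set t | _].
have AT : A (passage_time (station i w)).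
  move=> s; rewrite !user_distE; apply: ler_wsqrtr.
  by rewrite !sqdist_atE subrr expr0n/= lerD2r sqr_ge0.
have Au t : A t -> t = passage_time (station i w).
  move=> /(_ (passage_time (station i w))); rewrite !user_distE.
  rewrite ler_sqrt; last by rewrite sqdist_atE addr_ge0 ?sqr_ge0.
  rewrite !sqdist_atE subrr expr0n/= lerD2r => h.
  apply/eqP; rewrite -subr_eq0 -sqrf_eq0 eq_le h sqr_ge0//.
by case: xgetP => [t _ /Au//|/(_ _ AT)].
Qed.

(** The distances are compared through their squares. *)
Lemma closer_than_closest_dist i j w :
  user_dist 1 X Th j (closest_time 1 X Th i w) w < closest_dist 1 X Th i w <->
  closer_at_passage (station i w, station j w).
Proof.
rewrite /closest_dist closest_timeE !user_distE /closer_at_passage/=.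
rewrite [sqdist_at _ (station i w)]sqdist_atE subrr expr0n/= add0r.
set q := passage_offset _ ^+ 2; set a := sqdist_at _ _.
have a0 : 0 <= a by rewrite /a sqdist_atE addr_ge0 ?sqr_ge0.
have : 0 <= q by exact: sqr_ge0.
rewrite le_eqVlt => /predU1P[<-|q0]; last by rewrite ltr_sqrt.
by rewrite sqrtr0 !ltNge sqrtr_ge0 a0.
Qed.

End network.

Section marked_process.
Context d (Omega : measurableType d) (R : realType) (P : probability Omega R).
Variables (l : {nonneg R}).
Variables (X : nat -> {RV P >-> plane R}) (Theta : nat -> {RV P >-> R}).
Hypothesis l0 : 0 < l%:num.
Hypothesis X_poisson : homogeneous_poisson P l%:num (fun i => X i).
Hypothesis Theta_iid : iid_uniform_angles P (fun i => Theta i).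
Hypothesis X_Theta : independent_seqs P (fun i => X i) (fun i => Theta i).
Notation S := (plane R * measurableTypeR R)%type.

Let Z : nat -> Omega -> S := station (fun i => X i) (fun i => Theta i).

Let mX i : measurable_fun setT (X i : Omega -> plane R).
Proof. exact: measurable_funP. Qed.

Let mTheta i : measurable_fun setT (Theta i : Omega -> measurableTypeR R).
Proof. exact: (measurable_funP (Theta i)). Qed.

Let mZ i : measurable_fun setT (Z i).
Proof. exact: measurable_fun_pair. Qed.

Lemma intensity_measure_count_law (B : set (plane R)) n : measurable B ->
  (intensity_measure l B < +oo)%E ->
  P [set w | count_in R (fun i => X i) B w = n%:R%:E] =
  poisson_prob (fine (intensity_measure l B)) 0 [set n].
Proof.
move=> mB lB; have aB : (area B < +oo)%E.
  rewrite ltey; apply: contraTneq lB => aB.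
  by rewrite /intensity_measure /mscale/= aB gt0_muley ?lte_fin// ltxx.
rewrite (_ : fine _ = l%:num * fine (area B)); first exact: X_poisson.1.
by rewrite /intensity_measure /mscale/= fineM// ge0_fin_numE.
Qed.

(** Marking: integrating out the angles first turns the generating functional
    of the marked process into that of the stations. *)
Lemma marked_generating_functional (h : S -> R) : unit_interval_valued h ->
  (\int[marked_intensity l]_z (h z)%:E < +oo)%E ->
  (\int[P]_w (\prod_(j < n) (1 - h (Z j w)))%:E)%E @[n --> \oo] -->
  (expR (- fine (\int[marked_intensity l]_z (h z)%:E)%E))%:E.
Proof.
move=> h01 hoo; have [mh hi] := h01.
pose q := mark_mean (angle_law R) h.
have q01 : unit_interval_valued q by exact: unit_interval_valued_mark_mean.
have qE : (\int[marked_intensity l]_z (h z)%:E = \int[intensity_measure l]_x (q x)%:E)%E.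
  rewrite marked_tonelli1; last 2 first.
  - exact/measurable_EFinP.
  - by move=> z; rewrite lee_fin; case/andP: (hi z).
  by apply: eq_integral => x _; rewrite mark_meanE.
rewrite qE in hoo *.
have mean1 x : mark_mean (angle_law R) (fun z => 1 - h z) x = 1 - q x.
  have s01 := unit_interval_valued_section x h01.
  have : (\int[angle_law R]_y (1 - h (x, y))%:E + \int[angle_law R]_y (h (x, y))%:E = 1)%E.
    rewrite -ge0_integralD//.
    - under eq_integral do rewrite -EFinD subrK.
      exact: integral_uniform_cst.
    - by move=> y _; rewrite lee_fin; case: (unit_interval_valued_onem s01) => _ /(_ y)/andP[].
    - by apply/measurable_EFinP; case: (unit_interval_valued_onem s01).
    - by move=> y _; rewrite lee_fin; case: s01 => _ /(_ y)/andP[].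
    - by apply/measurable_EFinP; case: s01.
  have E1 := mark_meanE (angle_law R) x (unit_interval_valued_onem h01).
  have E2 := mark_meanE (angle_law R) x h01.
  by rewrite -E1 -E2 -EFinD => -[/(canRL (addrK _))].
rewrite (_ : (fun n => _) =
    (fun n => (\int[P]_w (\prod_(j < n) (1 - q (X j w)))%:E)%E)); last first.
  apply/funext => n.
  rewrite (expectation_marks (U := angle_law R) mX mTheta _ _ X_Theta
    (f := fun _ z => 1 - h z)); last 3 first.
  - by move=> i A mA; rewrite Theta_iid.1.
  - exact: Theta_iid.2.
  - by move=> i; exact: unit_interval_valued_onem.
  apply: eq_integral => w _; congr EFin; apply: eq_bigr => j _.
  exact: mean1.
apply: (generating_functional_poisson mX intensity_measure_count_law) => //.
exact: X_poisson.2.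
Qed.

Lemma point_sum_passage (r : R) : 0 <= r < 1 ->
  point_sum P Z r (@passage_window R) (@closer_at_passage R) =
  (Num.sqrt l%:num / Num.sqrt (1 - r))%:E.
Proof.
move=> r01; have r01' : 0 <= r <= 1 by case/andP: r01 => -> /ltW.
rewrite -(mean_sum_passage l0 r01) closer_at_passage_rectangles.
apply: mecke_pow_card => //.
- move=> A D mA mD AD muA muD.
  exact: (expected_sum_pow_card mZ marked_generating_functional mA mD AD muA muD r01').
- exact: measurable_early_window.
- exact: measurable_near_window.
- exact: early_near_window.
- exact: marked_intensity_near_window.
- move=> z; rewrite -closer_at_passage_rectangles.
  apply: (@le_lt_trans _ _ (l%:num * (pi * passage_offset z ^+ 2))%:E); last exact: ltry.
  by rewrite -xsection_closer_at_passage.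
- exact: measurable_passage_window.
Qed.

Lemma max_interference_processE w :
  max_interference_process 1 (fun i => X i) (fun i => Theta i) `[0%R, 1%R]%classic w =
  (\sum_(i <oo) (\1_(@passage_window R) (Z i w) *
     singleton_indicator R (seen_from Z (@closer_at_passage R) i w))%:E)%E.
Proof.
rewrite /max_interference_process counting_series; apply: eq_eseriesr => i _.
rewrite indicE /singleton_indicator -natrM mulnb; congr (nat_of_bool _)%:R%:E.
have seenE j : seen_from Z (@closer_at_passage R) i w j <->
    user_dist 1 (fun i => X i) (fun i => Theta i) j
      (closest_time 1 (fun i => X i) (fun i => Theta i) i w) w <
    closest_dist 1 (fun i => X i) (fun i => Theta i) i w.
  rewrite closer_than_closest_dist; split; first by move/xsectionP.
  by move=> h; apply/xsectionP.
apply/idP/andP => [/set_mem[h [j [hj uj]]]|[/set_mem h /asboolP[j [hj uj]]]].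
  split; first by apply/mem_set; rewrite /passage_window/= -closest_timeE.
  apply/asboolP; exists j; split; first exact/seenE.
  by move=> k /seenE; exact: uj.
apply/mem_set; split; first by rewrite closest_timeE.
exists j; split; first exact/seenE.
by move=> k /seenE; exact: uj.
Qed.

Lemma intensity_max_interference_process :
  intensity P (max_interference_process 1 (fun i => X i) (fun i => Theta i)) =
  (Num.sqrt l%:num / 2)%:E.
Proof.
have mC : measurable (@passage_window R) := @measurable_passage_window R.
have mU := @measurable_closer_at_passage R.
pose c i w : R := \1_(@passage_window R) (Z i w).
have c01 i : unit_interval_valued (c i).
  by apply: (unit_interval_valued_comp (mZ i)); exact: unit_interval_valued_indic.
have E01 i (r : R) : 0 <= r <= 1 ->
    unit_interval_valued (fun w => pow_card r (seen_from Z (@closer_at_passage R) i w)).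
  by move=> r01; exact: unit_interval_valued_seen_from.
rewrite -(expected_singletons (P := P) (sqrtr_ge0 _) c01 E01); last first.
  by move=> r r01; rewrite -point_sum_passage.
rewrite /intensity -integral_nneseries//.
- by apply: eq_integral => w _; exact: max_interference_processE.
- move=> i; apply/measurable_EFinP; apply: measurable_funM; first by case: (c01 i).
  by case: (unit_interval_valued_singleton E01 i).
- by move=> i w _; rewrite lee_fin mulr_ge0// /singleton_indicator.
Qed.

End marked_process.

Theorem lemma1 (R : realType) (d : measure_display) (Omega : measurableType d)
    (P : probability Omega R) (lambda : R)
    (X : nat -> {RV P >-> plane R}) (Theta : nat -> {RV P >-> R}) :
  0 < lambda ->
  homogeneous_poisson P lambda (fun i => X i) ->
  iid_uniform_angles P (fun i => Theta i) ->
  independent_seqs P (fun i => X i) (fun i => Theta i) ->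
  intensity P (max_interference_process 1 (fun i => X i) (fun i => Theta i)) =
    (Num.sqrt lambda / 2)%:E.
Proof.
move=> l0 X_poisson Theta_iid X_Theta.
exact: (@intensity_max_interference_process _ _ _ _ (NngNum (ltW l0))).
Qed.
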